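(* Let $\omega$ and $\nu$ be doubling weights on the unit disk $\mathbb{D}$, i.e. $\omega,\nu\in\mathcal{D}$. There exists a unique linear operator $R^{\omega,\nu}:\mathcal{H}\to\mathcal{H}$ with the following three properties: (1) $R^{\omega,\nu}:\mathcal{H}\to\mathcal{H}$ is continuous; (2) $(R^{\omega,\nu}f)_r=R^{\omega,\nu}(f_r)$ for every $f\in\mathcal{H}$ and every $r\in(0,1)$; (3) $R^{\omega,\nu}B_z^\omega(\xi)=B_z^\nu(\xi)$ for all $z,\xi\in\mathbb{D}$ (the operator acts on $B_z^\omega$ as a function of $\xi$).
   Context: $\mathbb{D}=\{z\in\mathbb{C}:|z|<1\}$, $dA=\pi^{-1}dx\,dy$. $\mathcal{H}$ is the space of all analytic functions on $\mathbb{D}$ with the topology of uniform convergence on compact sets. For $f\in\mathcal{H}$ and $r\in(0,1)$, $f_r(z)=f(rz)$. A weight is a non-negative function integrable on $\mathbb{D}$ with respect to $dA$; it is radial if $\omega(z)=\omega(|z|)$. For a radial weight put $\widehat{\omega}(r)=\int_r^1\omega(s)\,ds$, and assume throughout that $\widehat{\omega}(r)>0$ for all $r\in[0,1)$. A radial weight $\omega$ is in $\widehat{\mathcal{D}}$ if there is $C>0$ with $\widehat{\omega}(r)\le C\,\widehat{\omega}\left(\frac{1+r}{2}\right)$ for all $r\in[0,1)$; it is in $\check{\mathcal{D}}$ if there are $K>1$ and $C'>1$ with $\widehat{\omega}(r)\ge C'\,\widehat{\omega}\left(1-\frac{1-r}{K}\right)$ for all $r\in[0,1)$. $\omega$ is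 called doubling, $\omega\in\mathcal{D}$, if it belongs to both classes. $B_z^\omega$ is the reproducing kernel of the Hilbert space $A^2_\omega$ of analytic functions in $L^2(\mathbb{D},\omega\,dA)$: $f(z)=\int_{\mathbb{D}}f(\xi)\overline{B_z^\omega(\xi)}\omega(\xi)\,dA(\xi)$ for $f\in A^2_\omega$. Explicitly $B_z^\omega(\xi)=\sum_{k\ge0}\frac{1}{m_k(\omega)}(\overline{z}\xi)^k$, where $m_k(\omega)=2\int_0^1r^{2k+1}\omega(r)\,dr$. *)

(* Defs.v *)
From HB Require Import structures.
From mathcomp Require Import all_boot all_order all_algebra.
From mathcomp Require Import all_classical all_reals all_analysis.
From mathcomp Require Import complex.
Set Implicit Arguments.
Unset Strict Implicit.
Unset Printing Implicit Defensive.
Import Order.TTheory GRing.Theory Num.Theory.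
Import numFieldNormedType.Exports.
Local Open Scope classical_set_scope.
Local Open Scope ring_scope.

(* The topology on the complex numbers is carried by the alias R[i]^o. *)
Definition disk (R : realType) : set R[i]^o := [set z | `|z| < 1].
Arguments disk R : clear implicits.

(* As a type, disk R has the topology induced by R[i]^o. *)
Definition analytic (R : realType) : set (disk R -> R[i]^o) :=
  [set f | forall a : disk R, exists (c : nat -> R[i]) (e : R),
     0 < e /\
     forall w : disk R, `|val w - val a| < (e%:C)%C ->
       (series (fun n => c n * (val w - val a) ^+ n : R[i]^o)) @ \oo --> f w].
Arguments analytic R : clear implicits.

Section analytic_closed.
Variable R : realType.

Lemma analytic_submod : submod_closed (mem (analytic R)).
Proof.
split=> [|k f g /set_mem fA /set_mem gA]; apply/mem_set => a.
  exists (fun=> 0), 1; split=> // w _.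
  rewrite (_ : series _ = fun=> 0); first exact: cvg_cst.
  apply/funext => n; rewrite /series /=.
  by rewrite big1// => i _; rewrite mul0r.
have [c [e [e0 cf]]] := fA a; have [d [e' [e'0 dg]]] := gA a.
exists (fun n => k * c n + d n), (Num.min e e'); split.
  by rewrite lt_min e0.
move=> w wa.
have wae : `|val w - val a| < (e%:C)%C.
  by apply: (lt_le_trans wa); rewrite lecR ge_min lexx.
have wae' : `|val w - val a| < (e'%:C)%C.
  by apply: (lt_le_trans wa); rewrite lecR ge_min lexx orbT.
set u := fun n => c n * (val w - val a) ^+ n : R[i]^o.
set v := fun n => d n * (val w - val a) ^+ n : R[i]^o.
rewrite (_ : series _ = (fun n => (k : R[i]^o) *: series u n + series v n)).
  by apply: cvgD; [apply: cvgZr; exact: cf|exact: dg].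
apply/funext => n; rewrite /series /= scaler_sumr -big_split /=.
by apply: eq_bigr => i _; rewrite /u /v mulrDl -mulrA.
Qed.

End analytic_closed.


Definition hol (R : realType) : Type := set_type (analytic R).
Arguments hol R : clear implicits.

Section hol_structure.
Variable R : realType.

HB.instance Definition _ := SubChoice.on (hol R).

HB.instance Definition _ := GRing.SubChoice_isSubLmodule.Build R[i]
  (disk R -> R[i]^o) _ (hol R)
  (GRing.submod_closed_semi (analytic_submod R)).

(* Uniform convergence on the compact subsets of the disk. *)
HB.instance Definition _ := Topological.copy (hol R)
  (@initial_topology (hol R) {family compact, (disk R) -> R[i]^o} val).

End hol_structure.

Definition hol_fun (R : realType) (f : hol R) : disk R -> R[i]^o := val f.
Coercion hol_fun : hol >-> Funclass.

Section dilation.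
Variables (R : realType) (r : R) (r01 : 0 < r < 1).

Lemma disk_scale_subproof (z : disk R) :
  (((r%:C)%C * val z : R[i]^o) \in disk R).
Proof.
case/andP: r01 => r0 r1; apply/mem_set; rewrite /disk /=.
have z1 : `|val z| < 1 := set_mem (valP z).
rewrite normrM ger0_norm ?lecR ?ltW//.
apply: le_lt_trans z1; rewrite ler_piMl//.
by rewrite lecR ltW.
Qed.

Definition disk_scale (z : disk R) : disk R :=
  exist (fun x => x \in disk R) _ (disk_scale_subproof z).

Lemma dilate_subproof (f : hol R) : (f \o disk_scale) \in analytic R.
Proof.
case/andP: (r01) => r0 r1; apply/mem_set => a.
have [c [e [e0 cf]]] := set_mem (valP f) (disk_scale a).
exists (fun n => c n * (r%:C)%C ^+ n), e; split=> // w wa.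
rewrite (_ : (fun n => _) =
  fun n => c n * (val (disk_scale w) - val (disk_scale a)) ^+ n); last first.
  apply/funext => n /=.
  by rewrite -mulrBr exprMn mulrA.
apply: cf => /=; rewrite -mulrBr normrM ger0_norm ?lecR ?ltW//.
apply: le_lt_trans wa; rewrite ler_piMl//.
by rewrite lecR ltW.
Qed.

Definition dilate (f : hol R) : hol R :=
  exist (fun g => g \in analytic R) _ (dilate_subproof f).

End dilation.

Section area.
Variable R : realType.

(* Lebesgue measure on the completed (not merely Borel) sigma-algebra of the
   plane; (x, y) stands for x + iy. *)
Definition planar_lebesgue := @completed_measure_extension _ _ R
  (@lebesgue_measure R \x @lebesgue_measure R)%E.

Lemma invpi_ge0 : 0 <= (pi : R)^-1.
Proof. by rewrite invr_ge0 pi_ge0. Qed.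

Definition area_measure := mscale (NngNum invpi_ge0) planar_lebesgue.

Definition cplx (p : R * R) : R[i]^o := Complex p.1 p.2.

Definition plane_disk : set (R * R) := [set p | disk R (cplx p)].

(* Elements of hol R extended by 0 to the plane. *)
Definition plane_ext (f : hol R) (p : R * R) : R[i] :=
  oapp (hol_fun f) 0 (insub (cplx p)).

Definition area_cintegral (F : R * R -> R[i]) : R[i] :=
  Complex (\int[area_measure]_(p in plane_disk) complex.Re (F p))
          (\int[area_measure]_(p in plane_disk) complex.Im (F p)).

End area.
Arguments planar_lebesgue R : clear implicits.
Arguments area_measure R : clear implicits.
Arguments plane_disk R : clear implicits.

Section weights.
Variable R : realType.
(* Weights are total functions, but only their values on the disk matter. *)
Implicit Type w : R[i] -> R.

Definition is_weight w :=
  (forall z, disk R z -> 0 <= w z) /\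
  (area_measure R).-integrable (plane_disk R) (fun p => (w (cplx p))%:E).

Definition is_radial w := forall z, disk R z -> w z = w `|z|.

Definition tail_integral w (r : R) : \bar R :=
  (\int[completed_lebesgue_measure]_(s in `[r, 1%R[) (w (s%:C)%C)%:E)%E.

Definition upper_doubling w := exists2 C : R, 0 < C &
  forall r : R, 0 <= r < 1 ->
    (tail_integral w r <= C%:E * tail_integral w ((1 + r) / 2)%R)%E.

Definition lower_doubling w := exists K C : R, [/\ 1 < K, 1 < C &
  forall r : R, 0 <= r < 1 ->
    (C%:E * tail_integral w (1 - (1 - r) / K)%R <= tail_integral w r)%E].

(* Positivity of the tails is part of the standing assumptions. *)
Definition doubling_weight w :=
  [/\ is_weight w, is_radial w,
      forall r : R, 0 <= r < 1 -> (0 < tail_integral w r)%E,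
      upper_doubling w & lower_doubling w].

Definition bergman_space w (f : hol R) :=
  (area_measure R).-integrable (plane_disk R)
    (fun p => (complex.Re (`|plane_ext f p|) ^+ 2 * w (cplx p))%:E).

Definition reproducing_kernel w (B : disk R -> hol R) :=
  (forall z, bergman_space w (B z)) /\
  forall (f : hol R) (z : disk R), bergman_space w f ->
    f z = area_cintegral (fun p =>
      plane_ext f p * (plane_ext (B z) p)^*%C * ((w (cplx p))%:C)%C).

End weights.

(* Main.v *)
Require Import Defs.
From HB Require Import structures.
From mathcomp Require Import all_boot all_order all_algebra.
From mathcomp Require Import all_classical all_reals all_analysis.
From mathcomp Require Import measurable_realfun.
From mathcomp Require Import complex ring lra.
Import Order.TTheory GRing.Theory Num.Theory.
Import numFieldNormedType.Exports Normc.
Set Implicit Arguments.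
Unset Strict Implicit.
Unset Printing Implicit Defensive.
Local Open Scope classical_set_scope.
Local Open Scope ring_scope.

(* Every analytic function on the disk is the sum of a single power series
   [\sum_k a_k z ^ k]: averages over roots of unity give Cauchy's inequality, and
   Cauchy's inequality applied to the Taylor coefficients at the points of a circle
   enlarges the disk on which the expansion at 0 is valid by a fixed amount.

   Area measure is invariant under rotations (a rotation is a product of three
   shears), so the monomials are orthogonal for a radial weight [w]. Testing the
   reproducing formula on [xi ^ n] then shows that the coefficient of [xi ^ n] in
   [B_z] is [conj z ^ n / m_n w], with [0 < m_n w <= m_0 w]. Moreover [1 / m_n nu] grows
   subexponentially, simply because [Bnu_z] converges on the whole disk for every
   [z]. Hence [a_n |-> (m_n omega / m_n nu) a_n] defines an operator on [hol R], which is
   continuous by Cauchy's inequality. Conversely, an operator that commutes with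
   dilations is diagonal on the monomials, and its eigenvalues are read off from its
   action on one kernel [Bomega_z], [z != 0]. *)

(** * Rotation invariance of area measure *)

(** [analytic] promises at each point some power series on some small disk, with no control over how
    its radius and its coefficients depend on the point. The proof therefore avoids derivatives and
    contour integrals: coefficients are compared through values on small circles, and every estimate
    has the form |a_k| s ^ k <= M, whose slight loss of radius is harmless because the disk is open.
    The second obstacle is the exchange of sum and integral in the reproducing formula. A kernel is
    only known to be square integrable, so its series is integrated against the weight cut off at a
    radius r < 1, where it converges uniformly, and then r tends to 1. *)

Section rotation_invariance.
Variable R : realType.
Local Notation leb := (@lebesgue_measure R).
Local Notation R2 := (measurableTypeR R * measurableTypeR R)%type.

Lemma measurable_fun_translation (c : R) :
  measurable_fun setT (fun x : measurableTypeR R => x + c : measurableTypeR R).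
Proof. exact: measurable_funD. Qed.

(** The translated measure agrees with [leb] on half-open intervals, and these determine Lebesgue
    measure. *)
Lemma lebesgue_measure_translation (c : R) (A : set (measurableTypeR R)) :
  measurable A -> leb ((fun x => x + c) @^-1` A) = leb A.
Proof.
move=> mA; symmetry.
have mc := measurable_fun_translation c.
pose f : {mfun measurableTypeR R >-> measurableTypeR R} :=
  HB.pack (fun x : measurableTypeR R => x + c) (isMeasurableFun.Build _ _ _ _ _ mc).
have := @lebesgue_measure_unique R (pushforward leb f).
apply => // _ [[a b] _ <-] /=; rewrite /pushforward/=.
have -> : (fun x => x + c) @^-1` `]a, b] = `]a - c, b - c]%classic.
  by apply/seteqP; split => x /=; rewrite !in_itv/= => /andP[? ?]; apply/andP;
    split; lra.
rewrite !lebesgue_measure_itv/= !lte_fin; case: ifPn => ab.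
  by rewrite ifT; [rewrite -!EFinD; congr EFin; ring|lra].
by rewrite ifF//; apply/negbTE; lra.
Qed.

Definition vshear (a : R) (p : R2) : R2 := (p.1, p.2 + a * p.1).
Definition hshear (a : R) (p : R2) : R2 := (p.1 + a * p.2, p.2).

Lemma measurable_vshear a : measurable_fun setT (vshear a).
Proof.
apply/measurable_fun_pairP; split; first exact: measurable_fst.
have h1 : measurable_fun setT (fun p : R2 => a * p.1 : R).
  have hf : measurable_fun setT (fun p : R2 => p.1 : R) by exact: measurable_fst.
  exact: measurable_funM.
have hf : measurable_fun setT (fun p : R2 => p.2 : R) by exact: measurable_snd.
exact: (measurable_funD hf h1).
Qed.

Lemma measurable_hshear a : measurable_fun setT (hshear a).
Proof.
apply/measurable_fun_pairP; split; last exact: measurable_snd.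
have h1 : measurable_fun setT (fun p : R2 => a * p.2 : R).
  have hf : measurable_fun setT (fun p : R2 => p.2 : R) by exact: measurable_snd.
  exact: measurable_funM.
have hf : measurable_fun setT (fun p : R2 => p.1 : R) by exact: measurable_fst.
exact: (measurable_funD hf h1).
Qed.

(** A vertical shear translates each vertical section, and the product measure is the integral of
    the measures of those sections. *)
Lemma product_measure_vshear a (A : set R2) : measurable A ->
  (leb \x leb)%E (vshear a @^-1` A) = (leb \x leb)%E A.
Proof.
move=> mA; rewrite /product_measure1/=; apply: eq_integral => x _ /=.
rewrite -(lebesgue_measure_translation (a * x) (measurable_xsection x mA)).
by rewrite !xsectionE.
Qed.

Lemma product_measure_hshear a (A : set R2) : measurable A ->
  (leb \x leb)%E (hshear a @^-1` A) = (leb \x leb)%E A.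
Proof.
move=> mA.
(* Horizontal sections are the ones translated here, so the measure is first rewritten as the
   iterated integral in the other order. *)
have E (B : set R2) : measurable B -> (leb \x leb)%E B = (leb \x^ leb)%E B.
  by move=> mB; apply: product_measure_unique => //= *; rewrite product_measure2E.
have mB : measurable (hshear a @^-1` A).
  by rewrite -[X in measurable X]setTI; exact: measurable_hshear.
rewrite !E//.
rewrite /product_measure2/=; apply: eq_integral => y _ /=.
rewrite -(lebesgue_measure_translation (a * y) (measurable_ysection y mA)).
by rewrite !ysectionE.
Qed.

Definition rotation (c s : R) (p : R2) : R2 :=
  (c * p.1 - s * p.2, s * p.1 + c * p.2).

(** With c = cos x and s = sin x the parameter s / (1 + c) is tan (x / 2); the half-turn, where it
    is infinite, is excluded. *)
Lemma rotation_shears c s : c ^+ 2 + s ^+ 2 = 1 -> c != -1 ->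
  rotation c s = hshear (- (s / (1 + c))) \o vshear s \o hshear (- (s / (1 + c))).
Proof.
move=> cs1 c1; apply/funext => -[x y] /=; rewrite /rotation /hshear /vshear /=.
have c10 : 1 + c != 0 by rewrite addrC -[1]opprK subr_eq0.
have E : s * (s / (1 + c)) = 1 - c.
  by rewrite mulrA -expr2 -[s ^+ 2](addKr (c ^+ 2)) cs1; field.
have E2 : s / (1 + c) * (1 + c) = s by rewrite divfK.
set u := s / (1 + c) in E E2 *.
congr pair; last first.
  have -> : y + s * (x + - u * y) = s * x + (1 - s * u) * y by ring.
  by rewrite E; ring.
have -> : x + - u * y + - u * (y + s * (x + - u * y)) =
  (1 - s * u) * x - (u * (2 - s * u)) * y by ring.
have -> : 2 - s * u = 1 + c by rewrite E; ring.
by rewrite E2 E; ring.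
Qed.

Lemma measurable_rotation c s : measurable_fun setT (rotation c s).
Proof.
have h1 : measurable_fun setT (fun p : R2 => p.1 : R) by exact: measurable_fst.
have h2 : measurable_fun setT (fun p : R2 => p.2 : R) by exact: measurable_snd.
have hM (a : R) (f : R2 -> R) : measurable_fun setT f ->
    measurable_fun setT (fun p : R2 => a * f p : R).
  move=> mf; exact: (measurable_funM (measurable_cst a) mf).
apply/measurable_fun_pairP; split.
  exact: (measurable_funB (hM _ _ h1) (hM _ _ h2)).
exact: (measurable_funD (hM _ _ h1) (hM _ _ h2)).
Qed.

Lemma product_measure_rotation c s (A : set R2) :
  c ^+ 2 + s ^+ 2 = 1 -> c != -1 -> measurable A ->
  (leb \x leb)%E (rotation c s @^-1` A) = (leb \x leb)%E A.
Proof.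
move=> cs1 c1 mA; rewrite rotation_shears// !comp_preimage.
set t := - _.
have mh : measurable (hshear t @^-1` A).
  by rewrite -[X in measurable X]setTI; exact: measurable_hshear.
have mv : measurable (vshear s @^-1` (hshear t @^-1` A)).
  by rewrite -[X in measurable X]setTI; exact: measurable_vshear.
by rewrite product_measure_hshear// product_measure_vshear// product_measure_hshear.
Qed.

Lemma rotationK c s : c ^+ 2 + s ^+ 2 = 1 ->
  cancel (rotation c s) (rotation c (- s)).
Proof.
move=> cs1 [x y]; rewrite /rotation /=; congr pair.
  by rewrite -[RHS]mul1r -cs1; ring.
by rewrite -[RHS]mul1r -cs1; ring.
Qed.

End rotation_invariance.

(** * Outer measures under measure-preserving bijections *)

Section outer_measure_invariance.
Context d (T : measurableType d) (R : realType).
Variable mu : {measure set T -> \bar R}.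
Local Open Scope ereal_scope.

(** The preimage of a countable measurable cover of [X] covers the preimage of [X] at the same total
    cost, so the infimum can only drop. *)
Lemma mu_ext_preimage_le (g : T -> T) (X : set T) :
  measurable_fun setT g -> (forall A, measurable A -> mu (g @^-1` A) = mu A) ->
  mu_ext mu (g @^-1` X) <= mu_ext mu X.
Proof.
move=> mg gmu; apply: le_ereal_inf_tmp => _ [F [mF XF] <-].
apply: ereal_inf_lbound; exists (fun k => g @^-1` F k).
  split=> [k|x /XF[k _ Fk]]; last by exists k.
  by rewrite -[X in measurable X]setTI; exact: mg.
by apply: eq_eseriesr => k _; exact: gmu.
Qed.

Variables f g : T -> T.
Hypotheses (mf : measurable_fun setT f) (mg : measurable_fun setT g).
Hypothesis fmu : forall A, measurable A -> mu (f @^-1` A) = mu A.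
Hypothesis gmu : forall A, measurable A -> mu (g @^-1` A) = mu A.
Hypothesis fK : cancel f g.

(** The reverse inequality is the previous lemma for the inverse map, because [X] is the preimage
    under [f] of its own preimage under [g]. *)
Lemma mu_ext_preimage (X : set T) : mu_ext mu (g @^-1` X) = mu_ext mu X.
Proof.
apply/eqP; rewrite eq_le mu_ext_preimage_le//=.
have {1}-> : X = f @^-1` (g @^-1` X).
  by apply/seteqP; split => x /=; rewrite fK.
exact: mu_ext_preimage_le.
Qed.

End outer_measure_invariance.

Section planar_rotation.
Variable R : realType.
Local Notation leb := (@lebesgue_measure R).
Variables c s : R.
Hypotheses (cs1 : c ^+ 2 + s ^+ 2 = 1) (c1 : c != -1).

Let csN1 : c ^+ 2 + (- s) ^+ 2 = 1. Proof. by rewrite sqrrN. Qed.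

(** As a set function the completed measure is the outer measure [mu_ext], so invariance is
    available for every subset; the Caratheodory criterion uses it for arbitrary test sets. *)
Lemma planar_lebesgue_preimage_rotation A :
  planar_lebesgue R (rotation c s @^-1` A) = planar_lebesgue R A.
Proof.
apply: (@mu_ext_preimage _ _ _ (leb \x leb)%E (rotation c (- s))).
- exact: measurable_rotation.
- exact: measurable_rotation.
- by move=> *; exact: product_measure_rotation.
- by move=> *; exact: product_measure_rotation.
- by move=> p; have := rotationK csN1 p; rewrite opprK.
Qed.

End planar_rotation.

Lemma caratheodory_measurable_preimage (R : realType) (T : Type)
    (M : set T -> \bar R) (f g : T -> T) (A : set T) :
  (forall B, M (f @^-1` B) = M B) -> cancel f g ->
  caratheodory_measurable M A -> caratheodory_measurable M (f @^-1` A).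
Proof.
move=> fM fK mA X.
have -> : X = f @^-1` (g @^-1` X) by apply/seteqP; split => x /=; rewrite fK.
by rewrite preimage_setC -!preimage_setI !fM.
Qed.

Section area_rotation.
Variable R : realType.
Variables c s : R.
Hypotheses (cs1 : c ^+ 2 + s ^+ 2 = 1) (c1 : c != -1).
Local Notation plane :=
  (caratheodory_type (mu_ext (@lebesgue_measure R \x @lebesgue_measure R)%E)).

Lemma measurable_planar_rotation :
  measurable_fun [set: plane] (rotation c s : plane -> plane).
Proof.
move=> _ A mA; rewrite setTI.
exact: (caratheodory_measurable_preimage
  (planar_lebesgue_preimage_rotation cs1 c1) (rotationK cs1) mA).
Qed.

Lemma area_preimage_rotation A :
  area_measure R (rotation c s @^-1` A) = area_measure R A.
Proof. by congr (_ * _)%E; exact: planar_lebesgue_preimage_rotation. Qed.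

End area_rotation.

(** For nonnegative functions this is integration against the pushforward measure, which equals
    [mu]; the general case follows from positive and negative parts. *)
Lemma integral_measure_preserving d (T : measurableType d) (R : realType)
    (mu : {measure set T -> \bar R}) (f : T -> T) (D : set T) (F : T -> \bar R) :
  measurable_fun setT f -> (forall A, measurable A -> mu (f @^-1` A) = mu A) ->
  measurable D -> f @^-1` D = D -> measurable_fun D F ->
  (\int[mu]_(p in D) F (f p) = \int[mu]_(p in D) F p)%E.
Proof.
move=> mf fmu mD DE mF.
have ge0 (G : T -> \bar R) : measurable_fun D G -> (forall p, 0 <= G p)%E ->
    (\int[mu]_(p in D) G (f p) = \int[mu]_(p in D) G p)%E.
  move=> mG G0; rewrite -{1}DE -(@ge0_integral_pushforward _ _ _ _ _ _ mf)//.
  by apply: eq_measure_integral => A mA _; exact: fmu.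
rewrite integralE [RHS]integralE -[fun p => F (f p)]/(F \o f).
congr (_ - _)%E.
  rewrite -(ge0 _ (measurable_funepos mF) (funepos_ge0 F)).
  by apply: eq_integral => p _; rewrite funepos_comp.
rewrite -(ge0 _ (measurable_funeneg mF) (funeneg_ge0 F)).
by apply: eq_integral => p _; rewrite funeneg_comp.
Qed.

(** * Complex series *)

Section complex_series.
Variable R : realType.
Local Notation C := R[i].
Implicit Types (u a : nat -> C) (z w l : C).

Lemma normcEc z : `|z| = (normc z)%:C%C.
Proof. by []. Qed.

Lemma normc_ge0 z : 0 <= normc z.
Proof. by case: z => x y; exact: sqrtr_ge0. Qed.

Lemma normcX z n : normc (z ^+ n) = normc z ^+ n.
Proof. by elim: n => [|n IH]; rewrite ?expr0 ?normc1// !exprS normcM IH. Qed.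

Lemma normc_real (x : R) : normc (x%:C)%C = `|x|.
Proof. by rewrite /normc/= expr0n/= addr0 sqrtr_sqr. Qed.

Lemma normc_eq0 z : (normc z == 0) = (z == 0).
Proof. by apply/eqP/eqP => [/eq0_normc//|->]; exact: normc0. Qed.

Lemma normcB z w : normc (z - w) = normc (w - z).
Proof. by rewrite -normcN opprB. Qed.

Lemma normc_sum (I : Type) (r : seq I) (P : pred I) (F : I -> C) :
  normc (\sum_(i <- r | P i) F i) <= \sum_(i <- r | P i) normc (F i).
Proof.
elim/big_ind2 : _ => [|x1 x2 y1 y2 h1 h2|//]; first by rewrite normc0.
by apply: (le_trans (le_normcD _ _)); exact: lerD.
Qed.

Lemma normc_le_ReIm z : normc z <= `|complex.Re z| + `|complex.Im z|.
Proof.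
rewrite {1}(complexE z).
apply: (le_trans (le_normcD _ _)); rewrite normcM !normc_real.
suff -> : normc ('i%C : C) = 1 by rewrite mul1r.
by rewrite /= expr0n expr1n/= add0r sqrtr1.
Qed.

Lemma normc_ge_Re z : `|complex.Re z| <= normc z.
Proof.
case: z => x y /=; rewrite -sqrtr_sqr ler_wsqrtr// lerDl; exact: sqr_ge0.
Qed.

Lemma normc_ge_Im z : `|complex.Im z| <= normc z.
Proof.
case: z => x y /=; rewrite -sqrtr_sqr ler_wsqrtr// lerDr; exact: sqr_ge0.
Qed.

(** A total function, built from real limits; it carries meaning once the terms are dominated by a
    geometric sequence, the case treated in [csum_geo]. *)
Definition csum u : C :=
  Complex (limn (series (fun n => complex.Re (u n)))) (limn (series (fun n => complex.Im (u n)))).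

Lemma geo_dominated_series (v : nat -> R) (M q : R) : 0 <= q < 1 ->
  (forall k, `|v k| <= M * q ^+ k) ->
  forall N, `|limn (series v) - \sum_(k < N) v k| <= M * q ^+ N / (1 - q).
Proof.
move=> /andP[q0 q1] vM N.
have q1' : 0 < 1 - q by rewrite subr_gt0.
have cv : cvgn (series v).
  apply: normed_cvg; apply: (@series_le_cvg _ _ (geometric M q)) => //.
  - by move=> n; exact: normr_ge0.
  - by move=> n; apply: le_trans (vM n); exact: normr_ge0.
  - by apply: is_cvg_geometric_series; rewrite ger0_norm.
have M0 : 0 <= M by have := vM 0%N; rewrite expr0 mulr1; exact: le_trans (normr_ge0 _).
(* Keeping the exact finite geometric sum lets the induction on n close; the term q ^ n is dropped
   afterwards. *)
have bd n : (N <= n)%N ->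
    `|series v n - \sum_(k < N) v k| <= M * (q ^+ N - q ^+ n) / (1 - q).
  elim: n => [|n IH].
    by rewrite leqn0 => /eqP->; rewrite big_ord0 /series/= big_geq// !subrr mulr0 mul0r normr0.
  rewrite leq_eqVlt => /predU1P[->|].
    by rewrite /series/= big_mkord !subrr mulr0 mul0r normr0.
  rewrite ltnS => /IH{}IH.
  rewrite /series/= big_nat_recr//= addrAC.
  apply: (le_trans (ler_normD _ _)).
  apply: (le_trans (lerD IH (vM n))).
  by rewrite le_eqVlt; apply/orP; left; apply/eqP; rewrite exprS; field; rewrite lt0r_neq0.
have bd2 : \forall n \near \oo, `|series v n - \sum_(k < N) v k| <= M * q ^+ N / (1 - q).
  near=> n; apply: (le_trans (bd n _)); first by near: n; exact: nbhs_infty_ge.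
  apply: ler_wpM2r; first by rewrite invr_ge0 ltW.
  by apply: ler_wpM2l => //; rewrite gerBl exprn_ge0.
have cv2 : (fun n => `|series v n - \sum_(k < N) v k|) @ \oo --> `|limn (series v) - \sum_(k < N) v k|.
  by apply: cvg_norm; apply: cvgB => //; exact: cvg_cst.
by rewrite -(cvg_lim _ cv2)//; apply: limr_le => //; apply/cvg_ex; eexists; exact: cv2.
Unshelve. all: by end_near. Qed.

Lemma Re_sum (I : Type) (r : seq I) (P : pred I) (F : I -> C) :
  complex.Re (\sum_(i <- r | P i) F i) = \sum_(i <- r | P i) complex.Re (F i).
Proof. by apply: (big_morph (@complex.Re R)) => // -[? ?] []. Qed.

Lemma Im_sum (I : Type) (r : seq I) (P : pred I) (F : I -> C) :
  complex.Im (\sum_(i <- r | P i) F i) = \sum_(i <- r | P i) complex.Im (F i).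
Proof. by apply: (big_morph (@complex.Im R)) => // -[? ?] []. Qed.

Lemma ReB z w : complex.Re (z - w) = complex.Re z - complex.Re w.
Proof. by case: z w => ? ? []. Qed.

Lemma ImB z w : complex.Im (z - w) = complex.Im z - complex.Im w.
Proof. by case: z w => ? ? []. Qed.

Lemma csum_geo u (M q : R) : 0 <= q < 1 ->
  (forall k, normc (u k) <= M * q ^+ k) ->
  forall N, normc (csum u - \sum_(k < N) u k) <= 2 * M * q ^+ N / (1 - q).
Proof.
move=> q01 uM N; apply: (le_trans (normc_le_ReIm _)).
rewrite ReB ImB Re_sum Im_sum /=.
(* Real and imaginary parts contribute one geometric tail each, hence the factor 2. *)
have -> : 2 * M * q ^+ N / (1 - q) = M * q ^+ N / (1 - q) + M * q ^+ N / (1 - q) by ring.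
by apply: lerD; apply: geo_dominated_series => // k;
  [exact: le_trans (normc_ge_Re _) (uM k)|exact: le_trans (normc_ge_Im _) (uM k)].
Qed.

(** Convergence with a real epsilon: the norm of [R[i]^o] takes its values in [R[i]], whose partial
    order would otherwise enter every estimate. *)
Definition cvgc u l := forall e : R, 0 < e -> exists N, forall n, (N <= n)%N -> normc (u n - l) <= e.

Lemma cvgcP u l : (u : nat -> R[i]^o) @ \oo --> (l : R[i]^o) <-> cvgc u l.
Proof.
split=> [/cvgrPdist_le h e e0|h].
  have [|N _ hN] := h (e%:C)%C; first by rewrite ltcR.
  exists N => n /hN/=; rewrite -[X in X <= _]/((normc (l - u n))%:C)%C lecR.
  by rewrite normcB.
apply/cvgrPdist_le => e e0.
have [eI eR] : complex.Im e = 0 /\ 0 < complex.Re e.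
  by move: e0; rewrite ltcE/= => /andP[/eqP -> ->].
have -> : e = ((complex.Re e)%:C)%C by case: e eI {e0 eR} => ? ? /= ->.
have [N hN] := h _ eR; exists N => // n /hN/=.
by rewrite -[X in _ -> X <= _]/((normc (l - u n))%:C)%C lecR normcB.
Qed.

Lemma cvgc_unique u l w : cvgc u l -> cvgc u w -> l = w.
Proof.
move=> ul uw; apply/eqP; rewrite -subr_eq0 -normc_eq0; apply/eqP.
apply/le_anti; rewrite normc_ge0 andbT; apply/ler_addgt0Pr => e e0; rewrite add0r.
have e2 : 0 < e / 2 by rewrite divr_gt0.
have [N1 h1] := ul _ e2; have [N2 h2] := uw _ e2.
have -> : l - w = (u (maxn N1 N2) - w) - (u (maxn N1 N2) - l) by ring.
apply: (le_trans (le_normcD _ _)); rewrite normcN [leRHS]splitr.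
by apply: lerD; [apply: h2; exact: leq_maxr|apply: h1; exact: leq_maxl].
Qed.

Lemma geo_small (M q e : R) : 0 <= q < 1 -> 0 < e ->
  exists N, forall n, (N <= n)%N -> M * q ^+ n <= e.
Proof.
move=> /andP[q0 q1] e0.
have q1n : `|q| < 1 by rewrite ger0_norm.
have /cvgrPdist_le/(_ e e0) [N _ hN] := cvg_geometric M q1n.
exists N => n /hN/=; rewrite sub0r normrN; exact: le_trans (ler_norm _).
Qed.

Lemma csum_cvg u (M q : R) : 0 <= q < 1 ->
  (forall k, normc (u k) <= M * q ^+ k) -> cvgc (fun n => \sum_(k < n) u k) (csum u).
Proof.
move=> q01 uM e e0.
have [N hN] := geo_small (2 * M / (1 - q)) q01 e0.
exists N => n Nn; rewrite normcB; apply: (le_trans (csum_geo q01 uM n)).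
by have := hN _ Nn; congr (_ <= _); ring.
Qed.

Lemma csum_eq u l (M q : R) : 0 <= q < 1 ->
  (forall k, normc (u k) <= M * q ^+ k) -> cvgc (fun n => \sum_(k < n) u k) l ->
  csum u = l.
Proof. by move=> q01 uM ul; exact: cvgc_unique (csum_cvg q01 uM) ul. Qed.

Lemma cvgc_series_bounded u l : cvgc (fun n => \sum_(k < n) u k) l ->
  exists M, forall k, normc (u k) <= M.
Proof.
move=> h; have [N hN] := h 1 ltr01.
(* From N on, a term is the difference of two partial sums within 1 of the limit, hence at most 2;
   the earlier terms are covered by their sum. *)
exists (2 + \sum_(i < N) normc (u i)) => k.
have [kN|Nk] := ltnP k N.
  rewrite (bigD1 (Ordinal kN))//= addrCA lerDl addr_ge0// sumr_ge0// => *.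
  exact: normc_ge0.
have -> : u k = (\sum_(i < k.+1) u i - l) - (\sum_(i < k) u i - l).
  by rewrite big_ord_recr/=; ring.
apply: (le_trans (le_normcD _ _)); rewrite normcN.
apply: (@le_trans _ _ (1 + 1)); last by rewrite lerDl sumr_ge0// => *; exact: normc_ge0.
by apply: lerD; apply: hN => //; exact: leqW.
Qed.

End complex_series.

(** * Limit laws and elementary estimates *)

Section limits.
Variable R : realType.
Local Notation C := R[i].
Implicit Types (u v : nat -> C) (l m x : C).

Lemma cvgcD u v l m : cvgc u l -> cvgc v m -> cvgc (fun n => u n + v n) (l + m).
Proof.
move=> ul vm e e0; have e2 : 0 < e / 2 by rewrite divr_gt0.
have [N1 h1] := ul _ e2; have [N2 h2] := vm _ e2.
exists (maxn N1 N2) => n; rewrite geq_max => /andP[n1 n2].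
have -> : u n + v n - (l + m) = (u n - l) + (v n - m) by ring.
by apply: (le_trans (le_normcD _ _)); rewrite [leRHS]splitr lerD ?h1 ?h2.
Qed.

Lemma cvgcZ u l x : cvgc u l -> cvgc (fun n => u n * x) (l * x).
Proof.
move=> ul e e0; have x0 : 0 < normc x + 1 by rewrite ltr_wpDl ?normc_ge0.
have [N h] := ul _ (divr_gt0 e0 x0); exists N => n /h{}h.
rewrite -mulrBl normcM; apply: (@le_trans _ _ (e / (normc x + 1) * (normc x + 1))).
  by rewrite ler_pM ?normc_ge0// lerDl.
by rewrite divfK// gt_eqF.
Qed.

Lemma cvgc_cst l : cvgc (fun=> l) l.
Proof. by move=> e e0; exists 0%N => n _; rewrite subrr normc0 ltW. Qed.

Lemma cvgcB u v l m : cvgc u l -> cvgc v m -> cvgc (fun n => u n - v n) (l - m).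
Proof.
move=> ul vm; have := cvgcD ul (cvgcZ (-1) vm); rewrite mulrN1.
by under eq_fun do rewrite mulrN1.
Qed.

Lemma cvgc_sum (I : Type) (r : seq I) (u : I -> nat -> C) (l : I -> C) :
  (forall i, cvgc (u i) (l i)) ->
  cvgc (fun n => \sum_(i <- r) u i n) (\sum_(i <- r) l i).
Proof.
move=> ul; elim: r => [|i r IH].
  by rewrite big_nil; under eq_fun do rewrite big_nil; exact: cvgc_cst.
by rewrite big_cons; under eq_fun do rewrite big_cons; exact: cvgcD.
Qed.

Lemma cvgc_normc_le u l (B : R) : cvgc u l -> (forall n, normc (u n) <= B) -> normc l <= B.
Proof.
move=> ul uB; apply/ler_addgt0Pr => e e0; have [N /(_ _ (leqnn N)) h] := ul _ e0.
have -> : l = u N - (u N - l) by ring.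
by apply: (le_trans (le_normcD _ _)); rewrite normcN lerD.
Qed.

Lemma geo_tail_le (q : R) (N K : nat) : 0 <= q < 1 ->
  \sum_(k < K | (N <= k)%N) q ^+ k <= q ^+ N / (1 - q).
Proof.
move=> /andP[q0 q1]; have q1' : 0 < 1 - q by rewrite subr_gt0.
(* The subtracted power makes the claim inductive: the right-hand side is now the exact sum, which
   is 0 as long as K <= N. *)
suff H : \sum_(k < K | (N <= k)%N) q ^+ k <= (q ^+ N - q ^+ maxn N K) / (1 - q).
  by apply: (le_trans H); rewrite ler_wpM2r ?invr_ge0 ?(ltW q1')// gerBl exprn_ge0.
elim: K => [|K IH]; first by rewrite big_ord0 maxn0 subrr mul0r.
rewrite big_mkcond big_ord_recr/= -big_mkcond/=.
case: ifPn => NK.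
  apply: (le_trans (lerD IH (lexx _))); rewrite (maxn_idPr NK) (maxn_idPr (leqW NK)).
  by rewrite le_eqVlt; apply/orP; left; apply/eqP; rewrite exprS; field; rewrite lt0r_neq0.
rewrite -ltnNge in NK; rewrite addr0; apply: (le_trans IH).
by rewrite (maxn_idPl (ltnW NK)) (maxn_idPl NK).
Qed.

Lemma binomial_term_le (x y : R) (k n : nat) : 0 <= x -> 0 <= y ->
  'C(k, n)%:R * x ^+ (k - n) * y ^+ n <= (x + y) ^+ k.
Proof.
move=> x0 y0; have [kn|nk] := ltnP k n.
  by rewrite bin_small// !mul0r exprn_ge0// addr_ge0.
rewrite exprDn (bigD1 (Ordinal (nk : n < k.+1)%N))//= -mulrA mulr_natl lerDl.
by apply: sumr_ge0 => i _; rewrite mulrn_wge0// mulr_ge0// exprn_ge0.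
Qed.

End limits.

(** * Roots of unity of order a power of 2 *)

Section roots_of_unity.
Variable R : realType.
Local Notation C := R[i].

(** Orders that are powers of 2 suffice for the averages below, and such roots come from iterated
    square roots, without trigonometric functions. *)
Definition dyadic_root (z : C) := exists m, z ^+ (2 ^ m)%N = 1.

Lemma normc_dyadic_root z : dyadic_root z -> normc z = 1.
Proof.
move=> [m zm]; have : normc z ^+ (2 ^ m)%N = 1 by rewrite -normcX zm normc1.
by move/eqP; rewrite pexpr_eq1 ?normc_ge0 ?expn_gt0// => /eqP.
Qed.

Lemma exists_dyadic_primitive_root m :
  exists z : C, (2 ^ m.+1)%N.-primitive_root z.
Proof.
(* Repeated square roots of -1 give z with z ^ (2 ^ m) = -1; its order then divides 2 ^ (m + 1) but
   not 2 ^ m. *)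
have [z zm] : exists z : C, z ^+ (2 ^ m)%N = -1.
  elim: m => [|m [z zm]]; first by exists (-1); rewrite expn0 expr1.
  by exists (sqrtc z); rewrite expnS exprM sqr_sqrtc.
exists z; have z1 : z ^+ (2 ^ m.+1)%N = 1 by rewrite expnSr exprM zm sqrrN expr1n.
have [d dz] := prim_order_exists (expn_gt0 2 m.+1 : 0 < 2 ^ m.+1)%N z1.
move/(dvdn_pfactor _ _ (isT : prime 2)) => [j jm dj].
suff -> : m.+1 = j by rewrite -dj.
apply/eqP; rewrite eqn_leq jm andbT leqNgt; apply/negP; rewrite ltnS => jm'.
have : z ^+ (2 ^ m)%N = 1.
  by apply/eqP; rewrite -(prim_order_dvd dz) dj dvdn_exp2l.
rewrite zm => /eqP; rewrite eq_sym -subr_eq0 opprK -(natrD _ 1 1).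
by rewrite pnatr_eq0.
Qed.

Lemma sum_primitive_root N (z : C) (i : nat) : N.-primitive_root z ->
  \sum_(j < N) z ^+ (j * i)%N = if (N %| i)%N then N%:R else 0.
Proof.
move=> zN; case: ifPn => Ni.
  transitivity (\sum_(j < N) (1 : C)); last by rewrite sumr_const card_ord.
  apply: eq_bigr => j _; apply/eqP; rewrite -(prim_order_dvd zN).
  exact: dvdn_mull.
have z1 : z ^+ i - 1 != 0 by rewrite subr_eq0 -(prim_order_dvd zN).
apply: (mulfI z1); rewrite mulr0.
under eq_bigr do rewrite mulnC exprM.
by rewrite -subrX1 -exprM mulnC exprM (prim_expr_order zN) expr1n subrr.
Qed.

End roots_of_unity.

(** * Power series *)

Section power_series.
Variable R : realType.
Local Notation C := R[i].
Implicit Types (a b : nat -> C) (c h z : C) (r s t M B : R).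

(** Replaces the radius of convergence: a bound at s gives geometric convergence at every radius
    below s, with an explicit error. *)
Definition coef_bound a s M := forall k, normc (a k) * s ^+ k <= M.
Definition psum a z : C := csum (fun k => a k * z ^+ k).

Lemma coef_bound_ge0 a s M : coef_bound a s M -> 0 <= M.
Proof. by move/(_ 0%N); rewrite expr0 mulr1; apply: le_trans; exact: normc_ge0. Qed.

Lemma coef_bound_le a s t M : 0 <= t <= s -> coef_bound a s M -> coef_bound a t M.
Proof.
move=> /andP[t0 ts] h k; apply: le_trans (h k).
by rewrite ler_wpM2l ?normc_ge0// lerXn2r// nnegrE (le_trans t0).
Qed.

Lemma coef_term_le a s M t : 0 < s -> 0 <= t -> coef_bound a s M ->
  forall k, normc (a k) * t ^+ k <= M * (t / s) ^+ k.
Proof.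
move=> s0 t0 h k.
have -> : normc (a k) * t ^+ k = normc (a k) * s ^+ k * (t / s) ^+ k.
  by rewrite -mulrA -exprMn [s * _]mulrC divfK ?gt_eqF.
by rewrite ler_wpM2r ?exprn_ge0 ?divr_ge0// ltW.
Qed.

Lemma ratio01 s t : 0 <= t -> t < s -> 0 <= t / s < 1.
Proof.
by move=> t0 ts; have s0 := le_lt_trans t0 ts; rewrite divr_ge0 ?(ltW s0)//= ltr_pdivrMr ?mul1r.
Qed.

Lemma psum_error a s M z : coef_bound a s M -> normc z < s -> forall N,
  normc (psum a z - \sum_(k < N) a k * z ^+ k) <=
  2 * M * (normc z / s) ^+ N / (1 - normc z / s).
Proof.
move=> h zs; apply: csum_geo; first by rewrite ratio01// normc_ge0.
move=> k; rewrite normcM normcX; apply: coef_term_le => //; last exact: normc_ge0.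
exact: le_lt_trans (normc_ge0 _) zs.
Qed.

Lemma psum_cvg a s M z : coef_bound a s M -> normc z < s ->
  cvgc (fun n => \sum_(k < n) a k * z ^+ k) (psum a z).
Proof.
move=> h zs; apply: (@csum_cvg _ _ M (normc z / s)).
  by rewrite ratio01// normc_ge0.
move=> k; rewrite normcM normcX; apply: coef_term_le => //; last exact: normc_ge0.
exact: le_lt_trans (normc_ge0 _) zs.
Qed.

Lemma psum_le a s M z : coef_bound a s M -> normc z < s ->
  normc (psum a z) <= 2 * M / (1 - normc z / s).
Proof.
by move=> h zs; have := psum_error h zs 0; rewrite big_ord0 subr0 expr0 mulr1.
Qed.

Lemma normc_natr n : normc (n%:R : C) = n%:R.
Proof.
have -> : (n%:R : C) = ((n%:R : R)%:C)%C by rewrite rmorph_nat.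
by rewrite normc_real ger0_norm.
Qed.

(* Averaging over the 2^m-th roots of unity replaces the Cauchy integral formula. *)
Lemma cauchy_bound a s M r B : coef_bound a s M -> 0 <= r < s ->
  (forall z, dyadic_root z -> normc (psum a (r%:C%C * z)) <= B) ->
  coef_bound a r B.
Proof.
move=> h /andP[r0 rs] hB k; apply/ler_addgt0Pr => e e0.
have [m0 hm0] := geo_small (2 * M / (1 - r / s)) (ratio01 r0 rs) e0.
(* m >= m0 makes the error of truncation after N terms at most e on the circle of radius r, and m >=
   k gives k < N. *)
set m := maxn m0 k; set N := (2 ^ m.+1)%N.
have mN : (m < N)%N.
  by apply: (leq_trans (ltn_expl m (isT : 1 < 2)%N)); rewrite /N leq_exp2l.
have kN : (k < N)%N by rewrite (leq_ltn_trans _ mN)// leq_maxr.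
have [z zN] : exists z : C, N.-primitive_root z := exists_dyadic_primitive_root R m.
have N0 : 0 < N%:R :> R by rewrite ltr0n expn_gt0.
pose P w := \sum_(i < N) a i * w ^+ i.
(* A discrete Fourier coefficient of the polynomial [P]; the exponent N - k stands for -k, as z ^ N
   = 1. *)
have key : \sum_(j < N) z ^+ (j * (N - k))%N * P (r%:C%C * z ^+ j) =
    N%:R * (a k * (r%:C%C) ^+ k).
  under eq_bigr do rewrite mulr_sumr.
  rewrite exchange_big/=.
  transitivity (\sum_(i < N) (a i * r%:C%C ^+ i) * \sum_(j < N) z ^+ (j * (N - k + i))%N).
    apply: eq_bigr => i _; rewrite mulr_sumr; apply: eq_bigr => j _.
    by rewrite exprMn -exprM mulnDr exprD; ring.
  rewrite (bigD1 (Ordinal kN))//= [X in _ + X]big1 ?addr0; last first.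
    move=> i ik; rewrite (sum_primitive_root _ zN) ifF ?mulr0//.
    (* N - k + i lies strictly between 0 and 2 N, so N divides it only when i = k. *)
    apply/negP => /dvdnP[[|[|q]]].
    - by rewrite mul0n => /eqP; rewrite addn_eq0 subn_eq0 leqNgt kN.
    - rewrite mul1n => E; move/eqP: ik; apply; apply/val_inj => /=.
      by apply/eqP; rewrite -(eqn_add2l (N - k)) E subnK// ltnW.
    - move=> E; have : (N - k + i < N + N)%N.
        by rewrite -addnS leq_add// ?leq_subr// ltn_ord.
      by rewrite E !mulSn addnA -[X in (_ < X)%N]addn0 ltn_add2l.
  by rewrite subnK 1?ltnW// (sum_primitive_root _ zN) dvdnn mulrC.
have nz : normc z = 1 by apply: normc_dyadic_root; exists m.+1; exact: prim_expr_order.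
have nrz j : normc (r%:C%C * z ^+ j) = r.
  by rewrite normcM normcX nz expr1n mulr1 normc_real ger0_norm.
have : normc (N%:R * (a k * (r%:C%C) ^+ k)) <= N%:R * (B + e).
  rewrite -key; apply: (le_trans (normc_sum _ _ _)).
  apply: (@le_trans _ _ (\sum_(j < N) (B + e))); last first.
    by rewrite sumr_const card_ord mulr_natl.
  apply: ler_sum => j _; rewrite normcM normcX nz expr1n mul1r.
  have -> : P (r%:C%C * z ^+ j) = psum a (r%:C%C * z ^+ j) -
    (psum a (r%:C%C * z ^+ j) - P (r%:C%C * z ^+ j)) by ring.
  apply: (le_trans (le_normcD _ _)); rewrite normcN; apply: lerD.
    apply: hB; exists m.+1; rewrite -exprM mulnC exprM.
    by rewrite (prim_expr_order zN) expr1n.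
  have zs : normc (r%:C%C * z ^+ j) < s by rewrite nrz.
  apply: (le_trans (psum_error h zs N)); rewrite nrz.
  have -> : 2 * M * (r / s) ^+ N / (1 - r / s) = 2 * M / (1 - r / s) * (r / s) ^+ N by ring.
  by apply: hm0; apply: leq_trans (ltnW mN); exact: leq_maxl.
rewrite normcM normcM normcX normc_real (ger0_norm r0).
by rewrite normc_natr ler_pM2l.
Qed.

Lemma coef_boundB a b s M B : 0 <= s -> coef_bound a s M -> coef_bound b s B ->
  coef_bound (fun k => a k - b k) s (M + B).
Proof.
move=> s0 ha hb k; apply: le_trans (lerD (ha k) (hb k)).
rewrite -mulrDl ler_wpM2r ?exprn_ge0//; apply: (le_trans (le_normcD _ _)).
by rewrite normcN.
Qed.

Lemma psumB a b s M B z : coef_bound a s M -> coef_bound b s B -> normc z < s ->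
  psum (fun k => a k - b k) z = psum a z - psum b z.
Proof.
move=> ha hb zs; have s0 := le_lt_trans (normc_ge0 z) zs.
apply: cvgc_unique (psum_cvg (coef_boundB (ltW s0) ha hb) zs) _.
have := cvgcB (psum_cvg ha zs) (psum_cvg hb zs).
by under eq_fun do rewrite -sumrB (eq_bigr _ (fun i _ => esym (mulrBl _ _ _))).
Qed.

(** Cauchy's inequality with bound 0, applied to the difference of the two series, kills every
    coefficient. *)
Lemma psum_inj a b s M B r : coef_bound a s M -> coef_bound b s B -> 0 < r < s ->
  (forall z, dyadic_root z -> psum a (r%:C%C * z) = psum b (r%:C%C * z)) -> a = b.
Proof.
move=> ha hb /andP[r0 rs] ab; have s0 := lt_trans r0 rs.
have rs' : 0 <= r < s by rewrite ltW.
apply/funext => k.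
have := @cauchy_bound (fun k => a k - b k) s (M + B) r 0 (coef_boundB (ltW s0) ha hb) rs'.
have H z : dyadic_root z -> normc (psum (fun k => a k - b k) (r%:C%C * z)) <= 0.
  move=> zr; rewrite (psumB ha hb) ?ab ?subrr ?normc0//.
  by rewrite normcM (normc_dyadic_root zr) mulr1 normc_real ger0_norm// ltW.
move=> /(_ H)/(_ k); rewrite pmulr_lle0 ?exprn_gt0// => h.
apply/eqP; rewrite -subr_eq0 -normc_eq0.
by apply/eqP/le_anti; rewrite h normc_ge0.
Qed.

(** The Taylor coefficients at c, obtained by expanding each (c + h) ^ k; for k < n the binomial
    coefficient is 0, so the truncated exponent k - n is harmless. *)
Definition recenter a c n : C := csum (fun k => 'C(k, n)%:R * a k * c ^+ (k - n)).

(** Multiplied by d ^ n, the term is |a_k| times one summand of the binomial expansion of (|c| + d)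
    ^ k. *)
Lemma recenter_term_le a s M c (d : R) n k : 0 < d -> normc c + d < s ->
  coef_bound a s M ->
  normc ('C(k, n)%:R * a k * c ^+ (k - n)) <=
  M / d ^+ n * ((normc c + d) / s) ^+ k.
Proof.
move=> d0 cds h; have c0 := normc_ge0 c.
have s0 : 0 < s by apply: le_lt_trans cds; rewrite addr_ge0 // ltW.
rewrite [leRHS]mulrAC ler_pdivlMr ?exprn_gt0//.
have cd0 : 0 <= normc c + d by rewrite addr_ge0// ltW.
apply: le_trans (coef_term_le s0 cd0 h k).
have -> : normc ('C(k, n)%:R * a k * c ^+ (k - n)) * d ^+ n =
    normc (a k) * ('C(k, n)%:R * normc c ^+ (k - n) * d ^+ n).
  by rewrite !normcM normcX normc_natr; ring.
by rewrite ler_wpM2l ?normc_ge0// binomial_term_le// ltW.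
Qed.

Lemma recenter_bound a s M c (d : R) : 0 < d -> normc c + d < s -> coef_bound a s M ->
  coef_bound (recenter a c) d (2 * M / (1 - (normc c + d) / s)).
Proof.
move=> d0 cds h n.
have q01 : 0 <= (normc c + d) / s < 1.
  by apply: ratio01 => //; rewrite addr_ge0 ?normc_ge0// ltW.
have := csum_geo q01 (fun k => recenter_term_le n k d0 cds h) 0.
rewrite big_ord0 subr0 expr0 mulr1 -ler_pdivlMr ?exprn_gt0// => /le_trans; apply.
by rewrite le_eqVlt; apply/orP; left; apply/eqP; ring.
Qed.

Lemma psum_recenter a s M c h : coef_bound a s M -> normc c + normc h < s ->
  psum (recenter a c) h = psum a (c + h).
Proof.
move=> ha chs; have c0 := normc_ge0 c; have h0 := normc_ge0 h.
set q := (normc c + normc h) / s.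
have q01 : 0 <= q < 1 by apply: ratio01 => //; rewrite addr_ge0.
(* The midpoint of |h| and s - |c|. *)
pose d := (s - normc c + normc h) / 2.
have hd : normc h < d by rewrite /d ltr_pdivlMr//; lra.
have d0 : 0 < d by exact: le_lt_trans hd.
have cds : normc c + d < s by rewrite -ltrBrDl /d ltr_pdivrMr//; lra.
have s0 : 0 < s by apply: le_lt_trans chs; rewrite addr_ge0.
apply: cvgc_unique (psum_cvg (recenter_bound d0 cds ha) hd) _.
have chs' : normc (c + h) < s by exact: le_lt_trans (le_normcD _ _) chs.
move=> e e0.
have [N0 hN0] := geo_small (M / (1 - q)) q01 e0.
exists N0 => N N0N; apply: le_trans (hN0 N N0N).
rewrite normcB.
have qd01 : 0 <= (normc c + d) / s < 1 by apply: ratio01 => //; rewrite addr_ge0// ltW.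
(* For fixed N the error is the limit, as K grows, of finite double sums, which may be reordered; it
   remains to bound these uniformly in K. *)
have cv := cvgcB (psum_cvg ha chs') (@cvgc_sum _ _ (index_enum 'I_N)
  (fun n K => (\sum_(k < K) 'C(k, n)%:R * a k * c ^+ (k - n)) * h ^+ n) _
  (fun n => cvgcZ (h ^+ n) (csum_cvg qd01 (fun k => recenter_term_le n k d0 cds ha)))).
apply: (cvgc_normc_le cv) => K.
have -> : \sum_(n <- index_enum 'I_N) (\sum_(k < K) 'C(k, n)%:R * a k * c ^+ (k - n)) * h ^+ n
    = \sum_(k < K) a k * \sum_(n < N) 'C(k, n)%:R * c ^+ (k - n) * h ^+ n.
  under eq_bigr do rewrite mulr_suml.
  rewrite exchange_big/=; apply: eq_bigr => k _; rewrite mulr_sumr.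
  by apply: eq_bigr => n _; ring.
rewrite -sumrB; apply: (le_trans (normc_sum _ _ _)).
apply: (@le_trans _ _ (\sum_(k < K | (N <= k)%N) M * q ^+ k)); last first.
  rewrite -mulr_sumr -mulrA; apply: ler_wpM2l; first exact: coef_bound_ge0 ha.
  by rewrite mulrC; apply: geo_tail_le.
rewrite [leRHS]big_mkcond/=; apply: ler_sum => k _.
(* For k < N the sum over n < N is the whole binomial expansion and the difference vanishes. For k
   >= N the difference consists of some of the summands, whose moduli add up to at most (|c| + |h|)
   ^ k. *)
have E : (c + h) ^+ k = \sum_(n < k.+1) 'C(k, n)%:R * c ^+ (k - n) * h ^+ n.
  by rewrite exprDn; apply: eq_bigr => n _; rewrite mulr_natl mulrnAl.
rewrite -mulrBr normcM; case: leqP => Nk; last first.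
  rewrite E (big_ord_widen _ (fun n => 'C(k, n)%:R * c ^+ (k - n) * h ^+ n) Nk).
  rewrite big_mkcond/= -sumrB big1 ?normc0 ?mulr0// => n _; case: ifPn.
    by rewrite subrr.
  by rewrite -leqNgt => kn; rewrite bin_small// !mul0r subrr.
apply: (@le_trans _ _ (normc (a k) * (normc c + normc h) ^+ k)); last first.
  by apply: coef_term_le => //; exact: addr_ge0.
apply: ler_wpM2l; first exact: normc_ge0.
rewrite E (big_ord_widen _ (fun n => 'C(k, n)%:R * c ^+ (k - n) * h ^+ n) (leqW Nk)).
rewrite [X in _ - X]big_mkcond/= -sumrB; apply: (le_trans (normc_sum _ _ _)).
rewrite exprDn; apply: ler_sum => n _.
apply: (@le_trans _ _ (normc ('C(k, n)%:R * c ^+ (k - n) * h ^+ n))).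
  by case: ifPn => _; rewrite ?subrr ?subr0// normc0 normc_ge0.
by rewrite !normcM !normcX normc_natr mulr_natl mulrnAl.
Qed.

End power_series.

(** * Global power series expansions *)

Section global_expansion.
Variable R : realType.
Local Notation C := R[i].
Implicit Types (a b : nat -> C) (F : C -> C) (c h z w : C).

(** Radius and bound are arguments because compactness must later supply a single pair for all
    centres in a closed disk. *)
Definition expands F c (d M : R) :=
  exists2 b, coef_bound b d M & forall h, normc h < d -> F (c + h) = psum b h.

Lemma expands_le F c (d e M N : R) : 0 <= e <= d -> M <= N -> expands F c d M -> expands F c e N.
Proof.
move=> ed MN [b hb Fb]; exists b.
  by move=> k; apply: le_trans MN; exact: (coef_bound_le ed hb).
by move=> h he; apply: Fb; apply: lt_le_trans he _; case/andP: ed.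
Qed.

Lemma recenter_unique a b c (t d e M N : R) : coef_bound a t M -> normc c < t ->
  0 < d -> coef_bound b d N -> 0 < e ->
  (forall h, normc h < e -> psum b h = psum a (c + h)) -> b = recenter a c.
Proof.
move=> ha ct d0 hb e0 E; have c0 := normc_ge0 c.
pose t' := (t - normc c) / 2; have t'0 : 0 < t' by rewrite divr_gt0// subr_gt0.
have ct' : normc c + t' < t by rewrite -ltrBrDl /t' ltr_pdivrMr//; lra.
pose s := Num.min d t'; have s0 : 0 < s by rewrite lt_min d0.
have sd : 0 <= s <= d by rewrite ltW//= ge_min lexx.
have st' : 0 <= s <= t' by rewrite ltW//= ge_min lexx orbT.
pose r := Num.min (s / 2) (e / 2).
have r0 : 0 < r by rewrite lt_min !divr_gt0.
have rs : r < s by rewrite gt_min ltr_pdivrMr// ltr_pMr// (ltrDl 1 1 : (_ < 1 + 1) = _) ltr01.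
have re : r < e by rewrite gt_min [X in _ || X]ltr_pdivrMr// [X in _ || X]ltr_pMr// (ltrDl 1 1 : (_ < 1 + 1) = _) ltr01 orbT.
have hr := recenter_bound t'0 ct' ha.
apply: (@psum_inj _ _ _ s _ _ r (coef_bound_le sd hb) (coef_bound_le st' hr)).
  by rewrite r0.
move=> z zr; have nz : normc (r%:C%C * z) = r.
  by rewrite normcM (normc_dyadic_root zr) mulr1 normc_real gtr0_norm.
rewrite E ?nz// (psum_recenter ha)// nz.
apply: lt_trans ct'; rewrite ltrD2l; apply: (lt_le_trans rs).
by case/andP: st'.
Qed.

(** As a function of the centre, the n-th Taylor coefficient is itself a power series, so a bound
    for it on a circle can be fed to Cauchy's inequality. The terms of [recenter] with k < n vanish,
    whence the shift. *)
Lemma recenter_shift a c n (s M : R) : coef_bound a s M -> normc c < s ->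
  recenter a c n = psum (fun j => 'C(j + n, n)%:R * a (j + n)%N) c.
Proof.
move=> ha cs; have c0 := normc_ge0 c.
pose d := (s - normc c) / 2; have d0 : 0 < d by rewrite divr_gt0// subr_gt0.
have cds : normc c + d < s by rewrite -ltrBrDl /d ltr_pdivrMr//; lra.
have q01 : 0 <= (normc c + d) / s < 1 by apply: ratio01 => //; rewrite addr_ge0// ltW.
have bd k := recenter_term_le n k d0 cds ha.
have cv := csum_cvg q01 bd.
apply/esym; apply: (@csum_eq _ _ _ (M / d ^+ n * ((normc c + d) / s) ^+ n) _ q01).
  move=> j; have := bd (j + n)%N; rewrite addnK exprD => /le_trans; apply.
  by rewrite le_eqVlt; apply/orP; left; apply/eqP; ring.
move=> e e0; have [N hN] := cv e e0; exists N => K NK.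
have -> : \sum_(k < K) 'C(k + n, n)%:R * a (k + n)%N * c ^+ k =
    \sum_(k < n + K) 'C(k, n)%:R * a k * c ^+ (k - n).
  rewrite big_split_ord/= [X in _ = X + _]big1 ?add0r; last first.
    by move=> i _; rewrite bin_small// !mul0r.
  by apply: eq_bigr => i _; rewrite addnC addKn.
by apply: hN; apply: leq_trans NK (leq_addl _ _).
Qed.

Lemma shift_coef_bound a n (t e M : R) : 0 <= t -> 0 < e -> coef_bound a (t + e) M ->
  coef_bound (fun j => 'C(j + n, n)%:R * a (j + n)%N) t (M / e ^+ n).
Proof.
move=> t0 e0 ha j; rewrite ler_pdivlMr ?exprn_gt0//.
apply: le_trans (ha (j + n)%N).
have -> : normc ('C(j + n, n)%:R * a (j + n)%N) * t ^+ j * e ^+ n =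
    normc (a (j + n)%N) * ('C(j + n, n)%:R * t ^+ (j + n - n) * e ^+ n).
  by rewrite normcM normc_natr addnK; ring.
by rewrite ler_wpM2l ?normc_ge0// binomial_term_le// ltW.
Qed.

(** The bound M depends on t and may blow up as t approaches rho. *)
Definition expands_within F (rho : R) := exists a,
  (forall t, 0 <= t < rho -> exists M, coef_bound a t M) /\
  (forall z, normc z < rho -> F z = psum a z).

(* The uniform bounds on the coefficients at the points of a circle bound,
   by Cauchy's inequality for each of the series
   [\sum_k 'C(k, n) a_k z ^ (k - n)], the products ['C(k, n) |a_k|]; summing over
   [n] gives a bound for [|a_k|] on a larger disk. *)
Lemma expands_within_step F (s d rho M : R) : 0 < d -> d <= rho -> rho <= s ->
  (forall c, normc c <= s -> expands F c d M) ->
  expands_within F rho -> expands_within F (rho + d / 4).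
Proof.
move=> d0 drho rhos hF [a [ha Fa]].
have M0 : 0 <= M.
  have [|b hb _] := hF 0; last exact: coef_bound_ge0 hb.
  by rewrite normc0 (le_trans _ rhos)// (le_trans _ drho)// ltW.
(* The margin d / 4 leaves room inside rho for Cauchy's inequality, while local expansions of radius
   d around this circle reach beyond rho. *)
pose r := rho - d / 4.
have r0 : 0 < r by rewrite /r; lra.
(* By uniqueness near c, the local expansion given by [hF] is the recentred series, although its
   radius d may extend past rho. *)
have loc c (e : R) : 0 < e -> normc c + e <= rho ->
    exists2 b, b = recenter a c &
      coef_bound b d M /\ forall h, normc h < d -> F (c + h) = psum b h.
  move=> e0 ce; have c0 := normc_ge0 c.
  have [|b hb Fb] := hF c; first by lra.
  exists b; last by [].
  have [|M1 h1] := ha (normc c + e / 2); first by apply/andP; split; lra.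
  apply: (@recenter_unique a b c _ d (Num.min d e) _ _ h1 _ d0 hb).
  - by lra.
  - by rewrite lt_min d0.
  move=> h; rewrite lt_min => /andP[hd he]; rewrite -Fb// Fa//.
  by apply: (le_lt_trans (le_normcD _ _)); lra.
have key n k : (n <= k)%N -> 'C(k, n)%:R * normc (a k) * r ^+ (k - n) * d ^+ n <= M.
  move=> nk; rewrite -ler_pdivlMr ?exprn_gt0//.
  have [|M1 h1] := ha (r + d / 16 + d / 16); first by apply/andP; split; rewrite /r; lra.
  have e0 : 0 < d / 16 by lra.
  have re0 : 0 <= r + d / 16 by lra.
  have hs := shift_coef_bound n re0 e0 h1.
  have hr : 0 <= r < r + d / 16 by apply/andP; split; lra.
  have := cauchy_bound hs hr (B := M / d ^+ n).
  move=> /(_ _ (k - n)%N); rewrite subnK// normcM normc_natr; apply => z zr.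
  have nz : normc (r%:C%C * z) = r.
    by rewrite normcM (normc_dyadic_root zr) mulr1 normc_real gtr0_norm.
  rewrite -(recenter_shift n h1); last by rewrite nz; lra.
  have [||b -> [hb _]] := loc (r%:C%C * z) (d / 4); first by lra.
    by rewrite nz /r; lra.
  by rewrite ler_pdivlMr ?exprn_gt0.
have hbig : coef_bound a (rho + d / 4) (2 * M).
  (* After expanding (r + d / 2) ^ k, [key] bounds the n-th summand by M / 2 ^ n. *)
  move=> k; have -> : rho + d / 4 = r + d / 2 by rewrite /r; field.
  rewrite exprDn mulr_sumr.
  apply: (@le_trans _ _ (\sum_(n < k.+1) M * (2^-1) ^+ n)).
    apply: ler_sum => n _; rewrite exprMn -mulrnAr -mulr_natr.
    have -> : normc (a k) * (r ^+ (k - n) * (d ^+ n * 2^-1 ^+ n * 'C(k, n)%:R)) =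
      'C(k, n)%:R * normc (a k) * r ^+ (k - n) * d ^+ n * 2^-1 ^+ n by ring.
    by apply: ler_wpM2r; [rewrite exprn_ge0|apply: key; rewrite -ltnS ltn_ord].
  rewrite -mulr_sumr mulrC ler_wpM2r//.
  have h2 : 0 <= (2^-1 : R) < 1 by apply/andP; split; lra.
  have := @geo_tail_le R 2^-1 0 k.+1 h2.
  by rewrite expr0 div1r; have -> : 1 - 2^-1 = 2^-1 :> R by [field]; rewrite invrK.
exists a; split=> [t /andP[t0 tr]|w wrho].
  by exists (2 * M); apply: coef_bound_le hbig; rewrite t0 ltW.
have [/Fa //|rhow] := ltP (normc w) rho.
have w0 : 0 < normc w by lra.
(* A point w beyond rho is reached from the point c of modulus rho - d / 8 on the same ray: then |w
   - c| < 3 d / 8 < d. *)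
pose tau := (rho - d / 8) / normc w.
have tau0 : 0 <= tau by rewrite divr_ge0//; lra.
have tau1 : tau <= 1 by rewrite ler_pdivrMr// mul1r; lra.
pose c := tau%:C%C * w; pose h := (1 - tau)%:C%C * w.
have wch : w = c + h by rewrite /c /h -mulrDl -rmorphD/= addrC subrK rmorph1 mul1r.
have nc : normc c = rho - d / 8.
  by rewrite normcM normc_real ger0_norm// /tau divfK// gt_eqF.
have nh : normc h = normc w - (rho - d / 8).
  rewrite normcM normc_real ger0_norm ?subr_ge0// mulrBl mul1r /tau divfK//.
  by rewrite gt_eqF.
have [||b E [hb Fb]] := loc c (d / 8); [lra|rewrite nc; lra|].
rewrite wch Fb; last by rewrite nh; lra.
by rewrite E (psum_recenter hbig)// nc nh; lra.
Qed.

Lemma expands_within_le F (rho s : R) : s <= rho -> expands_within F rho -> expands_within F s.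
Proof.
move=> sr [a [ha Fa]]; exists a; split=> [t /andP[t0 ts]|z zs].
  by apply: ha; rewrite t0 (lt_le_trans ts).
by apply: Fa; exact: lt_le_trans sr.
Qed.

Lemma uniform_expands_within F (s d M : R) : 0 < d -> 0 < s ->
  (forall c, normc c <= s -> expands F c d M) -> expands_within F s.
Proof.
wlog ds : d / d <= s => [W d0 s0 hF|].
  apply: (W (Num.min d s)) => //; first by rewrite ge_min lexx orbT.
    by rewrite lt_min d0.
  move=> c /hF; apply: expands_le => //.
  by rewrite ge_min lexx andbT le_min !ltW.
move=> d0 s0 hF.
(* Each application of [expands_within_step] gains d / 4, until s is reached. *)
have step n : expands_within F (Num.min (d + n%:R * (d / 4)) s).
  elim: n => [|n IH].
    rewrite mul0r addr0 min_l//.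
    have [|a ha Fa] := hF 0; first by rewrite normc0 ltW.
    exists a; split=> [t /andP[t0 td]|z zd]; last by rewrite -Fa// add0r.
    by exists M; apply: coef_bound_le ha; rewrite t0 ltW.
  have n0 : 0 <= n%:R * (d / 4) by rewrite mulr_ge0//; lra.
  apply: expands_within_le (expands_within_step d0 _ _ hF IH).
  - rewrite ge_min; have [h|h] := leP (d + n%:R * (d / 4)) s.
      by rewrite -natr1 mulrDl mul1r addrA lexx.
    by apply/orP; right; lra.
  - by rewrite le_min ds andbT lerDl.
  - by rewrite ge_min lexx orbT.
have [n hn] : exists n : nat, s <= n%:R * (d / 4).
  exists (Num.truncn (s / (d / 4))).+1; rewrite -ler_pdivrMr; last by lra.
  by apply/ltW; exact: truncnS_gt.
by have := step n; rewrite min_r//; lra.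
Qed.

Lemma expands_within_unique F (s t : R) : 0 < s <= t ->
  forall a b, (forall u, 0 <= u < s -> exists M, coef_bound a u M) ->
  (forall z, normc z < s -> F z = psum a z) ->
  (forall u, 0 <= u < t -> exists M, coef_bound b u M) ->
  (forall z, normc z < t -> F z = psum b z) -> a = b.
Proof.
move=> /andP[s0 st] a b ha Fa hb Fb.
have [|M hM] := ha (s / 2); first by apply/andP; split; lra.
have [|N hN] := hb (s / 2); first by apply/andP; split; lra.
apply: (@psum_inj _ a b (s / 2) M N (s / 4) hM hN); first by apply/andP; split; lra.
move=> z zr; have nz : normc ((s / 4)%:C%C * z) = s / 4.
  by rewrite normcM (normc_dyadic_root zr) mulr1 normc_real gtr0_norm//; lra.
by rewrite -Fa ?nz -?Fb ?nz//; lra.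
Qed.

(** The series found at radius 1/2 serves every larger radius, since uniqueness identifies it with
    the series found there. *)
Lemma disk_expansion F :
  (forall s : R, 0 < s < 1 -> expands_within F s) -> expands_within F 1.
Proof.
move=> hF; have [|a [ha Fa]] := hF 2^-1; first by apply/andP; split; lra.
have H (s : R) : 2^-1 <= s < 1 ->
    (forall u, 0 <= u < s -> exists M, coef_bound a u M) /\
    (forall z, normc z < s -> F z = psum a z).
  move=> /andP[s2 s1]; have [|b [hb Fb]] := hF s; first by apply/andP; split; lra.
  have s20 : 0 < (2^-1 : R) <= s by apply/andP; split; lra.
  by rewrite (expands_within_unique s20 ha Fa hb Fb).
exists a; split=> [t /andP[t0 t1]|z z1].
  have [|h _] := H ((t + 1) / 2); first by apply/andP; split; lra.
  by apply: h; apply/andP; split; lra.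
have z0 := normc_ge0 z.
have [|_ h] := H ((normc z + 1) / 2); first by apply/andP; split; lra.
by apply: h; lra.
Qed.

End global_expansion.

(** * From local expansions to one power series on the disk *)

Section holomorphic.
Variable R : realType.
Local Notation C := R[i].
Implicit Types (a b : nat -> C) (f : hol R) (c h z w : C).

Lemma mem_disk z : ((z : R[i]^o) \in disk R) = (normc z < 1).
Proof.
by apply/idP/idP => [/set_mem|h]; [rewrite /disk/= ltcR|apply/mem_set; rewrite /disk/= ltcR].
Qed.

Lemma normc_disk (z : disk R) : normc (val z : C) < 1.
Proof. by rewrite -mem_disk; exact: valP. Qed.

Definition to_disk z (z1 : normc z < 1) : disk R :=
  exist (fun x => x \in disk R) (z : R[i]^o) (etrans (mem_disk z) z1).

Definition hol_ext f z : C := oapp (hol_fun f) 0 (insub (z : R[i]^o)).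

Lemma hol_ext_val f (z : disk R) : hol_ext f (val z) = f z.
Proof. by rewrite /hol_ext valK. Qed.

Lemma series_cvgc (u : nat -> C) (l : C) :
  (series (u : nat -> R[i]^o)) @ \oo --> (l : R[i]^o) <-> cvgc (fun n => \sum_(k < n) u k) l.
Proof.
rewrite cvgcP; have -> // : series (u : nat -> R[i]^o) = fun n => \sum_(k < n) u k.
by apply/funext => n; rewrite /series/= big_mkord.
Qed.

(** Recentring the series at c gives all nearby w the same radius and the same bound, the local
    uniformity on which compactness acts. *)
Lemma hol_ext_expands f c : normc c < 1 -> exists2 e : R, 0 < e &
  exists M, forall w, normc (w - c) < e -> expands (hol_ext f) w e M.
Proof.
move=> c1; have [a [e [e0 af]]] := set_mem (valP f) (to_disk c1).
(* With this d the point c + d lies in the disk and inside the local expansion, so convergence there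
   bounds the coefficients at radius d. *)
pose d := Num.min e (1 - normc c) / 2.
have de : d < e /\ d < 1 - normc c /\ 0 < d.
  have m0 : 0 < Num.min e (1 - normc c) by rewrite lt_min e0 subr_gt0.
  have md : d < Num.min e (1 - normc c) by rewrite /d ltr_pdivrMr//; lra.
  move: (md); rewrite lt_min => /andP[-> ->]; split=> //; split=> //.
  by rewrite divr_gt0.
case: de => de [d1 d0].
have cv h : normc h < e -> normc (c + h) < 1 ->
    cvgc (fun n => \sum_(k < n) a k * h ^+ k) (hol_ext f (c + h)).
  move=> he ch1; apply/(series_cvgc (fun k => a k * h ^+ k)).
  have := af (to_disk ch1); rewrite /= addrAC subrr add0r ltcR => /(_ he).
  by have := hol_ext_val f (to_disk ch1); rewrite /hol_fun/= => ->.
have [M hM] : exists M, coef_bound a d M.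
  have nd : normc (d%:C%C : C) = d by rewrite normc_real gtr0_norm.
  have cd1 : normc (c + d%:C%C) < 1.
    by apply: (le_lt_trans (le_normcD _ _)); rewrite nd; lra.
  have nde : normc (d%:C%C : C) < e by rewrite nd.
  have [M hM] := @cvgc_series_bounded _ (fun k => a k * d%:C%C ^+ k) _ (cv _ nde cd1).
  by exists M => k; have := hM k; rewrite normcM normcX nd.
have M0 := coef_bound_ge0 hM.
exists (d / 4); first by rewrite divr_gt0.
(* For |w - c| < d / 4 the ratio (|w - c| + d / 4) / d is at most 1/2, and 2 M / (1 - 1/2) = 4 M. *)
exists (4 * M) => w wc; have wc0 := normc_ge0 (w - c).
have d40 : 0 < d / 4 by rewrite divr_gt0.
have wd : normc (w - c) + d / 4 < d by lra.
exists (recenter a (w - c)).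
  move=> k; apply: le_trans (recenter_bound d40 wd hM k) _.
  have h2 : 2^-1 <= 1 - (normc (w - c) + d / 4) / d.
    rewrite lerBrDl -lerBrDr ler_pdivrMr//; lra.
  rewrite ler_pdivrMr; last by apply: lt_le_trans h2; rewrite invr_gt0.
  apply: (@le_trans _ _ (4 * M * 2^-1)); first by lra.
  by rewrite ler_wpM2l// mulr_ge0.
move=> h hd; have h0 := normc_ge0 h.
rewrite (psum_recenter hM); last by lra.
have -> : w + h = c + (w - c + h) by ring.
have nh : normc (w - c + h) < d by apply: (le_lt_trans (le_normcD _ _)); lra.
apply: cvgc_unique (cv _ _ _) (psum_cvg hM nh); first by lra.
by apply: (le_lt_trans (le_normcD _ _)); lra.
Qed.

Lemma near_cplx (x : R * R) (e : R) : 0 < e ->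
  \forall y \near x, normc ((cplx y : C) - cplx x) < e.
Proof.
move=> e0; have e2 : 0 < e / 2 by rewrite divr_gt0.
exists (ball x.1 (e / 2), ball x.2 (e / 2)); first by split; exact: nbhsx_ballx.
move=> y [/= h1 h2]; rewrite /ball/= in h1 h2.
have : normc ((cplx y : C) - cplx x) < e; last by [].
apply: (le_lt_trans (normc_le_ReIm _)); rewrite ReB ImB /=.
by rewrite [ltRHS]splitr ltrD// distrC.
Qed.

(** One natural number n encodes both the radius 1 / (n + 1) and the bound n, so compactness applies
    in its near-covering form along n tending to infinity. *)
Lemma hol_ext_uniform_expands f (s : R) : 0 < s < 1 -> exists2 d : R, 0 < d &
  exists M, forall c, normc c <= s -> expands (hol_ext f) c d M.
Proof.
move=> /andP[s0 s1].
have cK : compact ([set` `[-1, 1]] `*` [set` `[-1, 1]] : set (R * R)).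
  by apply: compact_setX; exact: segment_compact.
move/compact_near_coveringP: cK => /(_ nat \oo (fun n p => normc (cplx p : C) <= s ->
  expands (hol_ext f) (cplx p) (n.+1%:R^-1) n%:R)).
have step : forall x : R * R, ([set` `[-1, 1]] `*` [set` `[-1, 1]] : set (R * R)) x ->
    \forall x' \near x & n \near \oo, normc (cplx x' : C) <= s ->
      expands (hol_ext f) (cplx x') (n.+1%:R^-1) n%:R.
  (* If |x| >= 1, all points near x have modulus above s and the implication is vacuous. *)
  move=> x _; have [x1|x1] := ltP (normc (cplx x : C)) 1; last first.
    have s1' : 0 < 1 - s by rewrite subr_gt0.
    exists ([set y | normc ((cplx y : C) - cplx x) < 1 - s], setT).
      by split; [exact: near_cplx|exact: filterT].
    move=> [y n] [/= yx _] ys; exfalso.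
    have : normc (cplx x : C) <= normc (cplx y : C) + normc ((cplx y : C) - cplx x).
      have {1}-> : (cplx x : C) = cplx y - ((cplx y : C) - cplx x) by ring.
      by apply: (le_trans (le_normcD _ _)); rewrite normcN.
    have {}yx : normc ((cplx y : C) - cplx x) < 1 - s := yx.
    move=> xle; have := le_lt_trans (le_trans x1 xle) (ler_ltD ys yx).
    by rewrite addrC subrK ltxx.
  have [e e0 [M HM]] := hol_ext_expands f x1.
  exists ([set y | normc ((cplx y : C) - cplx x) < e],
    [set n : nat | n.+1%:R^-1 <= e /\ M <= n%:R]).
    split; first exact: near_cplx.
    near=> n; split.
      rewrite -[e]invrK lef_pV2 ?posrE ?invr_gt0//.
      apply: (@le_trans _ _ n%:R); last by rewrite ler_nat.
      by near: n; exact: nbhs_infty_ger.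
    by near: n; exact: nbhs_infty_ger.
  move=> [y n] [/= yx [ne Mn]] _.
  have {}yx : normc ((cplx y : C) - cplx x) < e := yx.
  apply: (@expands_le _ _ _ e n.+1%:R^-1 M n%:R _ Mn (HM _ yx)).
  by rewrite ne andbT invr_ge0 ler0n.
move=> /(_ _ step) [n _ /(_ n (leqnn n)) hn].
exists n.+1%:R^-1; first by rewrite invr_gt0.
exists n%:R => -[x y] cs; apply: (hn (x, y)) => //; split; rewrite /= in_itv/= -ler_norml.
  by apply: le_trans (normc_ge_Re (Complex x y)) _; apply: (le_trans cs); exact: ltW.
by apply: le_trans (normc_ge_Im (Complex x y)) _; apply: (le_trans cs); exact: ltW.
Unshelve. all: by end_near. Qed.

Lemma hol_expansion f : exists a,
  (forall t : R, 0 <= t < 1 -> exists M, coef_bound a t M) /\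
  (forall z : disk R, f z = psum a (val z)).
Proof.
have [s /[dup] s01 /andP[s0 s1]|a [ha Fa]] := @disk_expansion _ (hol_ext f).
  have [d d0 [M HM]] := hol_ext_uniform_expands f s01.
  exact: (uniform_expands_within d0 s0 HM).
by exists a; split=> // z; rewrite -hol_ext_val Fa//; exact: normc_disk.
Qed.

End holomorphic.

(** * Coefficients of analytic functions *)

Section coefficients.
Variable R : realType.
Local Notation C := R[i].
Implicit Types (a b : nat -> C) (f g : hol R) (c h z w : C).

Definition disk_coefs a := forall t : R, 0 <= t < 1 -> exists M, coef_bound a t M.

Definition coef f : nat -> C := sval (cid (hol_expansion f)).

Lemma coef_disk_coefs f : disk_coefs (coef f).
Proof. by rewrite /coef; case: cid => a []. Qed.

Lemma coefE f (z : disk R) : f z = psum (coef f) (val z).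
Proof. by rewrite /coef; case: cid => a []. Qed.

Lemma psum_analytic a : disk_coefs a ->
  ((fun z : disk R => psum a (val z) : R[i]^o) : disk R -> R[i]^o) \in analytic R.
Proof.
move=> ha; apply/mem_set => z0; have z1 := normc_disk z0.
pose d := (1 - normc (val z0 : C)) / 2.
have d0 : 0 < d by rewrite divr_gt0// subr_gt0.
have n0 := normc_ge0 (val z0 : C).
have [|M hM] := ha (normc (val z0 : C) + d + d / 2).
  by rewrite /d; apply/andP; split; lra.
have zd : normc (val z0 : C) + d < normc (val z0 : C) + d + d / 2 by lra.
exists (recenter a (val z0)), d; split=> // w.
rewrite normcEc ltcR => wd.
apply/(series_cvgc (fun k => recenter a (val z0) k * (val w - val z0) ^+ k)).
have := psum_cvg (recenter_bound d0 zd hM) wd.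
rewrite (psum_recenter hM); last by lra.
by rewrite [val z0 + _]addrC subrK.
Qed.

Definition mkhol a (ha : disk_coefs a) : hol R :=
  exist (fun u => u \in analytic R) _ (psum_analytic ha).

Lemma disk_coefs_inj a b : disk_coefs a -> disk_coefs b ->
  (forall z : disk R, psum a (val z) = psum b (val z)) -> a = b.
Proof.
move=> ha hb ab.
have [|M hM] := ha (2^-1); first by apply/andP; split; lra.
have [|N hN] := hb (2^-1); first by apply/andP; split; lra.
apply: (@psum_inj _ a b _ M N 4^-1 hM hN); first by apply/andP; split; lra.
move=> z zr; have nz : normc ((4^-1 : R)%:C%C * z) < 1.
  by rewrite normcM (normc_dyadic_root zr) mulr1 normc_real gtr0_norm; lra.
exact: (ab (to_disk nz)).
Qed.

Lemma coef_unique f a : disk_coefs a -> (forall z : disk R, f z = psum a (val z)) -> coef f = a.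
Proof.
move=> ha fa; apply: disk_coefs_inj => //; first exact: coef_disk_coefs.
by move=> z; rewrite -coefE fa.
Qed.

Lemma coef_mkhol a (ha : disk_coefs a) : coef (mkhol ha) = a.
Proof. exact: coef_unique. Qed.

Lemma hol_eq f g : (forall z : disk R, f z = g z) -> f = g.
Proof. by move=> fg; apply: val_inj; apply/funext => z; exact: fg. Qed.

Lemma coef_inj f g : coef f = coef g -> f = g.
Proof. by move=> fg; apply: hol_eq => z; rewrite !coefE fg. Qed.

(* No a priori bound is needed: convergence at a point of modulus [t] bounds the
   terms of the series there. *)
Lemma coef_cvgc f a :
  (forall z : disk R, cvgc (fun n => \sum_(k < n) a k * (val z : C) ^+ k) (f z)) ->
  coef f = a.
Proof.
move=> fa.
have ha : disk_coefs a.
  move=> t /andP[t0 t1].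
  have nt : normc (t%:C%C : C) < 1 by rewrite normc_real ger0_norm.
  have [M hM] := @cvgc_series_bounded _ (fun k => a k * t%:C%C ^+ k) _ (fa (to_disk nt)).
  by exists M => k; have := hM k; rewrite normcM normcX normc_real ger0_norm.
apply: coef_unique => // z; have z1 := normc_disk z; have z0 := normc_ge0 (val z : C).
have [|M hM] := ha ((normc (val z : C) + 1) / 2); first by apply/andP; split; lra.
by apply: cvgc_unique (fa z) (psum_cvg hM _); lra.
Qed.

Lemma coef_cvg f (z : disk R) : cvgc (fun n => \sum_(k < n) coef f k * (val z : C) ^+ k) (f z).
Proof.
have z1 := normc_disk z; have z0 := normc_ge0 (val z : C).
have [|M hM] := @coef_disk_coefs f ((normc (val z : C) + 1) / 2); first by apply/andP; split; lra.
by rewrite coefE; apply: psum_cvg hM _; lra.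
Qed.

Lemma coef_lin (x : C) f g : coef (x *: f + g) = fun k => x * coef f k + coef g k.
Proof.
apply: coef_cvgc => z.
have -> : hol_fun (x *: f + g) z = f z * x + g z by rewrite mulrC.
have := cvgcD (cvgcZ x (coef_cvg f z)) (coef_cvg g z).
congr cvgc; apply/funext => n; rewrite mulr_suml -big_split/=.
by apply: eq_bigr => k _; ring.
Qed.

Lemma coefZ (x : C) f : coef (x *: f) = fun k => x * coef f k.
Proof.
apply: coef_cvgc => z.
have -> : hol_fun (x *: f) z = f z * x by rewrite mulrC.
have := cvgcZ x (coef_cvg f z); congr cvgc; apply/funext => n; rewrite mulr_suml.
by apply: eq_bigr => k _; ring.
Qed.

Lemma coefB f g : coef (f - g) = fun k => coef f k - coef g k.
Proof.
by rewrite addrC -scaleN1r coef_lin; apply/funext => k; ring.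
Qed.

Lemma coef_dilate (r : R) (r01 : 0 < r < 1) f :
  coef (dilate r01 f) = fun k => r%:C%C ^+ k * coef f k.
Proof.
apply: coef_cvgc => z; have := coef_cvg f (disk_scale r01 z).
congr cvgc; apply/funext => n; apply: eq_bigr => k _.
by rewrite /= exprMn; ring.
Qed.

Definition monomial_coefs (k n : nat) : C := (n == k)%:R.

Lemma monomial_disk_coefs k : disk_coefs (monomial_coefs k).
Proof.
move=> t /andP[t0 t1]; exists 1 => n; rewrite /monomial_coefs normc_natr.
case: eqP => _; last by rewrite mul0r.
by rewrite mul1r exprn_ile1// ltW.
Qed.

Definition monomial k : hol R := mkhol (monomial_disk_coefs k).

Lemma coef_monomial k : coef (monomial k) = monomial_coefs k.
Proof. exact: coef_mkhol. Qed.

Lemma hol_sumE (I : Type) (r : seq I) (F : I -> hol R) (z : disk R) :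
  hol_fun (\sum_(i <- r) F i) z = \sum_(i <- r) F i z.
Proof. by elim: r => [|i r IH]; rewrite ?big_nil// !big_cons -IH. Qed.

Lemma monomialE k (z : disk R) : monomial k z = (val z : C) ^+ k.
Proof.
apply: cvgc_unique (coef_cvg _ _) _ => e e0; exists k.+1 => n kn.
rewrite (bigD1 (Ordinal kn))//= coef_monomial /monomial_coefs eqxx mul1r.
rewrite big1 ?addr0 ?subrr ?normc0 ?ltW// => i ik.
by rewrite (negbTE (_ : val i != k)) ?mul0r//; apply: contra ik.
Qed.

End coefficients.

(** * Uniform convergence on compact sets *)

Section hol_topology.
Variable R : realType.
Local Notation C := R[i].
Implicit Types (a b : nat -> C) (f g : hol R) (z w : C).

Lemma compact_disk_bound (K : set (disk R)) : compact K ->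
  exists2 s : R, 0 <= s < 1 & forall z : disk R, K z -> normc (val z : C) <= s.
Proof.
move/compact_near_coveringP => /(_ nat \oo (fun n (z : disk R) => normc (val z : C) <= 1 - n.+1%:R^-1)).
have step (x : disk R) : K x ->
    \forall x' \near x & n \near \oo, normc (val x' : C) <= 1 - n.+1%:R^-1.
  move=> _; have x1 := normc_disk x; set e := (1 - normc (val x : C)) / 2.
  have e0 : 0 < e by rewrite divr_gt0// subr_gt0.
  exists ([set y | normc ((val y : C) - val x) < e], [set n : nat | n.+1%:R^-1 <= e]).
    split; last first.
      near=> n; rewrite /= -[e]invrK lef_pV2 ?posrE ?invr_gt0//.
      apply: (@le_trans _ _ n%:R); last by rewrite ler_nat.
      by near: n; exact: nbhs_infty_ger.
    have : val @ x --> (val x : R[i]^o) by exact: initial_continuous.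
    move/cvgrPdist_lt => /(_ e%:C%C); rewrite ltcR => /(_ e0).
    apply: filterS => y h.
    have {}h : normc ((val x : C) - val y) < e by rewrite -ltcR; exact: h.
    by rewrite normcB in h.
  move=> [y n] [yx ne].
  have {}yx : normc ((val y : C) - val x) < e := yx.
  have {}ne : n.+1%:R^-1 <= e := ne.
  have : normc (val y : C) <= normc (val x : C) + normc ((val y : C) - val x).
    have {1}-> : (val y : C) = val x + ((val y : C) - val x) by ring.
    exact: le_normcD.
  have E : e + e = 1 - normc (val x : C) by rewrite /e -splitr.
  move: E yx ne; set p := normc _; set q := normc _; set r := normc _; set u := _^-1.
  by move=> *; lra.
move=> /(_ _ step) [n _ /(_ n (leqnn n)) hn].
exists (1 - n.+1%:R^-1) => //.
rewrite subr_ge0 invf_le1// ler1n/= gtrBl invr_gt0//.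
Unshelve. all: by end_near. Qed.

Lemma nbhs_disk (x : disk R) (U : set (disk R)) : nbhs x U ->
  exists2 e : R, 0 < e & forall z : disk R, normc ((val z : C) - val x) < e -> U z.
Proof.
move=> [B [[A oA <-] Ax] AU].
have /nbhs_ballP[e e0 eA] : nbhs (val x : R[i]^o) A by exact: open_nbhs_nbhs.
have [eI eR] : complex.Im e = 0 /\ 0 < complex.Re e.
  by move: (e0 : 0 < e); rewrite ltcE/= => /andP[/eqP -> ->].
exists (complex.Re e) => // z zx; apply: AU; apply: eA.
have -> : e = ((complex.Re e)%:C)%C by case: e eI {e0 eR zx} => ? ? /= ->.
rewrite -ball_normE /=.
have : (normc ((val x : C) - val z))%:C%C < (complex.Re e)%:C%C by rewrite ltcR normcB.
by [].
Qed.

(** Near-covering is transported from a square of the real plane: the property at p speaks of the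
    disk points with value [cplx p], and is vacuous near points of modulus greater than s. *)
Lemma compact_closed_disk (s : R) : s < 1 -> compact [set z : disk R | normc (val z : C) <= s].
Proof.
move=> s1; apply/compact_near_coveringP => I F P FF cover.
have cK : compact ([set` `[-1, 1]] `*` [set` `[-1, 1]] : set (R * R)).
  by apply: compact_setX; exact: segment_compact.
move/compact_near_coveringP : cK => /(_ I F (fun i p => forall z : disk R,
  (val z : C) = cplx p -> normc (val z : C) <= s -> P i z)) H.
have step (x : R * R) : ([set` `[-1, 1]] `*` [set` `[-1, 1]] : set (R * R)) x ->
    \forall x' \near x & i \near F, forall z : disk R,
      (val z : C) = cplx x' -> normc (val z : C) <= s -> P i z.
  move=> _; have [xs|sx] := leP (normc (cplx x : C)) s; last first.
    have d0 : 0 < normc (cplx x : C) - s by rewrite subr_gt0.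
    exists ([set y | normc ((cplx y : C) - cplx x) < normc (cplx x : C) - s], setT).
      by split; [exact: near_cplx|exact: filterT].
    move=> [y i] [yx _] z zy zs; exfalso.
    have {}yx : normc ((cplx y : C) - cplx x) < normc (cplx x : C) - s := yx.
    have {}zy : (val z : C) = cplx y := zy.
    have : normc (cplx x : C) <= normc (cplx y : C) + normc ((cplx y : C) - cplx x).
      have {1}-> : (cplx x : C) = cplx y - ((cplx y : C) - cplx x) by ring.
      by apply: (le_trans (le_normcD _ _)); rewrite normcN.
    rewrite zy in zs.
    by move=> xle; have := le_lt_trans xle (ler_ltD zs yx); rewrite addrC subrK ltxx.
  have x1 := le_lt_trans xs s1.
  have [[U V] [/= nU nV] UV] := cover (to_disk x1) xs.
  have [e e0 eU] := nbhs_disk nU.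
  exists ([set y | normc ((cplx y : C) - cplx x) < e], V).
    by split => //; exact: near_cplx.
  move=> [y i] [yx Vi] z zy zs; apply: (UV (z, i)); split=> //=; apply: eU.
  have {}zy : (val z : C) = cplx y := zy.
  by rewrite zy; exact: yx.
have {}H := H FF step.
near=> i => z zs.
have : (([set` `[-1, 1]] `*` [set` `[-1, 1]]) : set (R * R)) `<=` (fun p => forall z : disk R,
  (val z : C) = cplx p -> normc (val z : C) <= s -> P i z) by near: i; exact: H.
have zs' : normc (val z : C) <= 1 by apply: le_trans zs _; exact: ltW.
move=> /(_ (complex.Re (val z : C), complex.Im (val z : C))); apply => //.
  by split; rewrite /= in_itv/= -ler_norml;
    [apply: le_trans (normc_ge_Re _) zs'|apply: le_trans (normc_ge_Im _) zs'].
by case: (val z).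
Unshelve. all: by end_near. Qed.

(** The sets of functions close to f on a closed disk generate a filter. Every compact set lies in
    such a disk, so the filter converges to f uniformly on compact sets, and each neighbourhood of f
    contains one of these sets. *)
Lemma nbhs_holP f (V : set (hol R)) : nbhs f V -> exists s e : R,
  [/\ 0 <= s < 1, 0 < e & forall g, (forall z : disk R, normc (val z : C) <= s ->
    normc (g z - f z) < e) -> V g].
Proof.
move=> [B [[N oN <-] Nf] NV].
have nN : nbhs (hol_fun f : {family compact, (disk R) -> R[i]^o}) N.
  exact: open_nbhs_nbhs.
pose G (p : R * R) : set (disk R -> R[i]^o) := [set g | forall z : disk R,
  normc (val z : C) <= p.1 -> normc ((g z : C) - f z) < p.2].
pose D : set (R * R) := [set p | 0 <= p.1 < 1 /\ 0 < p.2].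
have FF : Filter (filter_from D G).
  apply: filter_from_filter; first by exists (0, 1); split => //=; rewrite lexx ltr01.
  move=> [s e] [s' e'] /= [/andP[s0 s1] e0] [/andP[s0' s1'] e0'].
  exists (Num.max s s', Num.min e e').
    by split=> /=; [rewrite le_max s0 gt_max s1|rewrite lt_min e0].
  move=> g /= Gg; split=> z zs.
    by have := Gg z; rewrite le_max zs => /(_ isT); rewrite lt_min => /andP[].
  by have := Gg z; rewrite le_max zs orbT => /(_ isT); rewrite lt_min => /andP[].
have : {family compact, filter_from D G --> (hol_fun f : disk R -> R[i]^o)}.
  apply/fam_cvgP => A cA; have [s s01 sA] := compact_disk_bound cA.
  move=> W /uniform_nbhs[E [entE EW]].
  have [e e0 eE] : exists2 e : R, 0 < e & forall z w : C, normc (w - z) < e -> E (z, w).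
    move: entE; rewrite -entourage_ballE => -[e e0 eE].
    have [eI eR] : complex.Im e = 0 /\ 0 < complex.Re e.
      by move: (e0 : 0 < e); rewrite ltcE/= => /andP[/eqP -> ->].
    exists (complex.Re e) => // z w zw; apply: eE; rewrite /= -ball_normE /=.
    have -> : e = ((complex.Re e)%:C)%C by case: e eI {e0 eR zw} => ? ? /= ->.
    have : (normc (z - w))%:C%C < (complex.Re e)%:C%C by rewrite ltcR normcB.
    by [].
  exists (s, e) => // g Gg; apply: EW => z Az; apply: eE; apply: Gg.
  exact: sA.
move=> /(_ N nN) [[s e] [s01 e0] GO]; exists s, e; split=> // g fg.
by apply: NV; apply: GO => z zs; exact: fg.
Qed.

Lemma nbhs_hol f (s e : R) : s < 1 -> 0 < e ->
  nbhs f [set g : hol R | forall z : disk R, normc (val z : C) <= s ->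
    normc ((g z : C) - f z) < e].
Proof.
move=> s1 e0.
have cv : (val : hol R -> {family compact, (disk R) -> R[i]^o}) @ f --> (hol_fun f : {family compact, (disk R) -> R[i]^o}).
  exact: initial_continuous.
have nE : nbhs (hol_fun f : {family compact, (disk R) -> R[i]^o})
    [set g | forall z : disk R, [set z : disk R | normc (val z : C) <= s] z ->
      [set p : R[i]^o * R[i]^o | ball p.1 (e%:C)%C p.2] (f z, g z)].
  apply: fam_nbhs; last exact: compact_closed_disk.
  by rewrite -entourage_ballE; exists (e%:C)%C => //=; rewrite ltcR.
have H' := cv _ nE; rewrite nbhs_filterE/= in H'.
apply: filterS H' => g H z zs; have := H z zs.
rewrite /= -ball_normE /= => h.
by rewrite normcB -ltcR; exact: h.
Qed.

End hol_topology.

(** * Diagonal operators *)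

Section multiplier.
Variable R : realType.
Local Notation C := R[i].
Implicit Types (a b gam : nat -> C) (f g : hol R) (z w : C).

(** For s between t and 1, t ^ k = (t / s) ^ k s ^ k, and one factor is spent on each sequence. *)
Lemma disk_coefsM gam a : disk_coefs gam -> disk_coefs a -> disk_coefs (fun k => gam k * a k).
Proof.
move=> hg ha t /andP[t0 t1].
have [s [s0 s1 ts]] : exists s : R, [/\ 0 < s, s < 1 & t / s < 1].
  exists ((1 + t) / 2); split; [lra|lra|].
  by rewrite ltr_pdivrMr ?mul1r; lra.
have [|M hM] := hg (t / s); first by rewrite ts divr_ge0// ltW.
have [|N hN] := ha s; first by rewrite s1 ltW.
exists (M * N) => k.
have -> : normc (gam k * a k) * t ^+ k = (normc (gam k) * (t / s) ^+ k) * (normc (a k) * s ^+ k).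
  by rewrite normcM mulrACA -exprMn divfK// gt_eqF.
by rewrite ler_pM// mulr_ge0 ?normc_ge0 ?exprn_ge0 ?divr_ge0// ltW.
Qed.

Definition multiplier gam (hg : disk_coefs gam) f : hol R :=
  mkhol (disk_coefsM hg (@coef_disk_coefs _ f)).

Lemma coef_multiplier gam (hg : disk_coefs gam) f :
  coef (multiplier hg f) = fun k => gam k * coef f k.
Proof. exact: coef_mkhol. Qed.

Lemma multiplier_linear gam (hg : disk_coefs gam) : linear (multiplier hg).
Proof.
move=> x f g; apply: coef_inj; rewrite coef_lin !coef_multiplier coef_lin.
by apply/funext => k; ring.
Qed.

Lemma multiplier_dilate gam (hg : disk_coefs gam) f (r : R) (r01 : 0 < r < 1) :
  dilate r01 (multiplier hg f) = multiplier hg (dilate r01 f).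
Proof.
apply: coef_inj; rewrite coef_dilate !coef_multiplier coef_dilate.
by apply/funext => k; ring.
Qed.

Lemma multiplier_continuous gam (hg : disk_coefs gam) : continuous (multiplier hg).
Proof.
move=> f V /nbhs_holP[s [e [/andP[s0 s1] e0 eV]]].
(* s < t < u < 1: Cauchy's inequality is used at u, the passage from u to t pays for the growth of
   [gam], and the series is summed at radius s below t. *)
pose u := (1 + s) / 2; pose t := (u + s) / 2.
have su : s < u by rewrite /u; lra.
have tu : t < u by rewrite /t /u; lra.
have u1 : u < 1 by rewrite /u; lra.
have u0 : 0 < u by rewrite /u; lra.
have ts : s < t by rewrite /t /u; lra.
have t0 : 0 < t by rewrite /t /u; lra.
have [|M hM] := hg (t / u).
  by rewrite divr_ge0 ?(ltW t0) ?(ltW u0)//= ltr_pdivrMr ?mul1r.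
have M0 := coef_bound_ge0 hM.
have st0 : 0 < 1 - s / t by rewrite subr_gt0 ltr_pdivrMr ?mul1r.
(* Chosen so that 2 M d / (1 - s / t) < e; M + 1 keeps the denominator positive. *)
pose d := e * (1 - s / t) / (2 * (M + 1)).
have M1 : 0 < M + 1 by rewrite ltr_wpDl.
have d0 : 0 < d by rewrite divr_gt0 ?mulr_gt0.
have := nbhs_hol f u1 d0; apply: filterS => g gf.
apply: eV => z zs.
have ch : coef_bound (fun k => coef g k - coef f k) u d.
  rewrite -coefB.
  have [|N hN] := @coef_disk_coefs _ (g - f) ((1 + u) / 2); first by apply/andP; split; lra.
  apply: (cauchy_bound hN); first by apply/andP; split; lra.
  move=> y yr.
  have ny : normc (u%:C%C * y) = u.
    by rewrite normcM (normc_dyadic_root yr) mulr1 normc_real gtr0_norm.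
  have ny1 : normc (u%:C%C * y) < 1 by rewrite ny.
  have yu : normc (val (to_disk ny1) : C) <= u by rewrite -[leRHS]ny lexx.
  have E : hol_fun (g - f) (to_disk ny1) = psum (coef (g - f)) (u%:C%C * y).
    exact: coefE.
  by rewrite -E; exact: ltW (gf _ yu).
have cm : coef_bound (coef (multiplier hg g - multiplier hg f)) t (M * d).
  rewrite coefB !coef_multiplier => k; rewrite -mulrBr normcM.
  have -> : normc (gam k) * normc (coef g k - coef f k) * t ^+ k =
    (normc (gam k) * (t / u) ^+ k) * (normc (coef g k - coef f k) * u ^+ k).
    by rewrite mulrACA -exprMn divfK// gt_eqF.
  have tu0 : 0 <= t / u by rewrite divr_ge0// ltW.
  by apply: ler_pM => //; rewrite mulr_ge0 ?normc_ge0 ?exprn_ge0// ltW.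
have -> : (multiplier hg g) z - (multiplier hg f) z =
    hol_fun (multiplier hg g - multiplier hg f) z by [].
rewrite coefE; have zt : normc (val z : C) < t by exact: le_lt_trans zs ts.
apply: (le_lt_trans (psum_le cm zt)).
have zt0 : 0 < 1 - normc (val z : C) / t by rewrite subr_gt0 ltr_pdivrMr ?mul1r.
rewrite ltr_pdivrMr//.
apply: (@lt_le_trans _ _ (e * (1 - s / t))); last first.
  by rewrite ler_pM2l// lerD2l lerN2 ler_pM2r ?invr_gt0.
have -> : e * (1 - s / t) = 2 * ((M + 1) * d) by rewrite /d; field; rewrite !gt_eqF.
by rewrite ltr_pM2l// ltr_pM2r// ltrDl.
Qed.

Lemma dilation_monomial k (r : R) (r01 : 0 < r < 1) :
  dilate r01 (monomial R k) = (r%:C%C ^+ k) *: monomial R k.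
Proof.
apply: coef_inj; rewrite coef_dilate coefZ coef_monomial /monomial_coefs.
by apply/funext => n; case: eqP => [->//|_]; rewrite !mulr0.
Qed.

Lemma hol_eval_cvg (u : nat -> hol R) f (z : disk R) :
  u @ \oo --> f -> cvgc (fun n => u n z) (f z).
Proof.
move=> uf e e0.
have [N _ hN] := uf _ (nbhs_hol f (normc_disk z) e0).
by exists N => n Nn; apply/ltW; exact: hN.
Qed.

(** Polynomials are thus dense, and a continuous linear operator is determined by its values on the
    monomials. *)
Lemma partial_sums_cvg f :
  (fun n => \sum_(k < n) coef f k *: monomial R k) @ \oo --> f.
Proof.
move=> V /nbhs_holP[s [e [/andP[s0 s1] e0 eV]]].
have [|M hM] := @coef_disk_coefs _ f ((1 + s) / 2); first by apply/andP; split; lra.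
set t := (1 + s) / 2 in hM.
have st : s < t by rewrite /t; lra.
have t0 : 0 < t by rewrite /t; lra.
have q1 := ratio01 s0 st.
have st0 : 0 < 1 - s / t by rewrite subr_gt0 ltr_pdivrMr ?mul1r.
have M0 := coef_bound_ge0 hM.
have e2 : 0 < e / 2 by rewrite divr_gt0.
have [N hN] := geo_small (2 * M / (1 - s / t)) q1 e2.
exists N => // n /hN{}hN; apply: eV => z zs.
have -> : hol_fun (\sum_(k < n) coef f k *: monomial R k) z =
    \sum_(k < n) coef f k * (val z : C) ^+ k.
  by rewrite hol_sumE; apply: eq_bigr => k _; rewrite -monomialE.
rewrite normcB coefE; have zt : normc (val z : C) < t by exact: le_lt_trans zs st.
apply: (le_lt_trans (psum_error hM zt n)).
apply: (@le_lt_trans _ _ (e / 2)); last by rewrite ltr_pdivrMr//; lra.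
apply: le_trans hN.
have zt0 : 0 < 1 - normc (val z : C) / t by rewrite subr_gt0 ltr_pdivrMr ?mul1r.
have z0 := normc_ge0 (val z : C).
have h1 : normc (val z : C) / t <= s / t by rewrite ler_pM2r ?invr_gt0.
have q0 : 0 <= normc (val z : C) / t by rewrite divr_ge0// ltW.
rewrite [leRHS]mulrAC; apply: ler_pM.
- by rewrite mulr_ge0 ?mulr_ge0 ?exprn_ge0.
- by rewrite invr_ge0 ltW.
- by rewrite ler_wpM2l ?mulr_ge0// lerXn2r// nnegrE// (le_trans q0).
- by rewrite lef_pV2 ?posrE// lerD2l lerN2.
Qed.

(* Dilation by [r] multiplies the n-th coefficient of [T (monomial R k)] by [r ^ n],
   but it must multiply all of them by [r ^ k]. *)
Lemma dilation_invariant_diagonal (T : hol R -> hol R) :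
  linear T -> continuous T ->
  (forall f (r : R) (r01 : 0 < r < 1), dilate r01 (T f) = T (dilate r01 f)) ->
  exists gam, forall f, coef (T f) = fun k => gam k * coef f k.
Proof.
move=> Tlin Tcont Tdil.
have TD f g : T (f + g) = T f + T g by have := Tlin 1 f g; rewrite !scale1r.
have T0 : T 0 = 0 by have := Tlin (-1) 0 0; rewrite scaler0 addr0 scaleN1r addNr.
have TZ x f : T (x *: f) = x *: T f by have := Tlin x f 0; rewrite T0 !addr0.
have h01 : 0 < (2^-1 : R) < 1 by apply/andP; split; lra.
have Tmon k n : n != k -> coef (T (monomial R k)) n = 0.
  move=> nk.
  have := congr1 (fun f => coef f n) (Tdil (monomial R k) _ h01).
  rewrite dilation_monomial TZ coef_dilate coefZ => /eqP.
  rewrite -subr_eq0 -mulrBl mulf_eq0 => /orP[|/eqP//].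
  rewrite -!rmorphXn -rmorphB/= => /eqP[/eqP]; rewrite subr_eq0 => /eqP E.
  have h0 : 0 < (2^-1 : R) by lra.
  have h1 : (2^-1 : R) != 1 by apply/eqP; lra.
  by move/(ieexprIn h0 h1): E nk => ->; rewrite eqxx.
exists (fun k => coef (T (monomial R k)) k) => f; apply: coef_cvgc => z.
have cv : (fun n => T (\sum_(k < n) coef f k *: monomial R k)) @ \oo --> T f.
  exact: (cvg_comp _ _ (@partial_sums_cvg f) (Tcont f)).
have := hol_eval_cvg z cv; congr cvgc; apply/funext => n.
rewrite (big_morph T TD T0) hol_sumE; apply: eq_bigr => k _.
rewrite TZ mulrAC mulrC.
have -> : hol_fun (coef f k *: T (monomial R k)) z = coef f k * T (monomial R k) z by [].
congr (_ * _).
apply: cvgc_unique (coef_cvg _ _) _ => e e0; exists k.+1 => m km.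
have -> : \sum_(i < m) coef (T (monomial R k)) i * (val z : C) ^+ i =
    coef (T (monomial R k)) k * (val z : C) ^+ k.
  rewrite (bigD1 (Ordinal km))//= big1 ?addr0// => i ik.
  by rewrite Tmon ?mul0r//; apply: contra ik.
by rewrite subrr normc0 ltW.
Qed.

End multiplier.

(** * Complex-valued integrals *)

Section complex_integral.
Context d (T : measurableType d) (R : realType) (mu : {measure set T -> \bar R}).
Variables (D : set T) (mD : measurable D).
Local Notation C := R[i].
Implicit Types (F G : T -> C) (g : T -> R).

Definition cint F : C := Complex (\int[mu]_(p in D) complex.Re (F p))
                                 (\int[mu]_(p in D) complex.Im (F p)).

Definition cmeasurable F :=
  measurable_fun D (fun p => complex.Re (F p)) /\ measurable_fun D (fun p => complex.Im (F p)).

Definition cintegrable F :=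
  mu.-integrable D (fun p => (complex.Re (F p))%:E) /\
  mu.-integrable D (fun p => (complex.Im (F p))%:E).

Lemma cmeasurable_real g : measurable_fun D g -> cmeasurable (fun p => (g p)%:C%C).
Proof. by move=> mg; split => //=; exact: measurable_cst. Qed.

Lemma cmeasurable_cst (x : C) : cmeasurable (fun=> x).
Proof. by split; exact: measurable_cst. Qed.

Lemma ReM (x y : C) : complex.Re (x * y) =
  complex.Re x * complex.Re y - complex.Im x * complex.Im y.
Proof. by case: x y => ? ? []. Qed.

Lemma ImM (x y : C) : complex.Im (x * y) =
  complex.Re x * complex.Im y + complex.Im x * complex.Re y.
Proof. by case: x y => ? ? []. Qed.

Lemma cmeasurableM F G : cmeasurable F -> cmeasurable G -> cmeasurable (fun p => F p * G p).
Proof.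
move=> [F1 F2] [G1 G2]; split.
  under eq_fun do rewrite ReM.
  by apply: measurable_funB; exact: measurable_funM.
under eq_fun do rewrite ImM.
by apply: measurable_funD; exact: measurable_funM.
Qed.

Lemma cmeasurableD F G : cmeasurable F -> cmeasurable G -> cmeasurable (fun p => F p + G p).
Proof.
move=> [F1 F2] [G1 G2]; split.
  have -> : (fun p => complex.Re (F p + G p)) = fun p => complex.Re (F p) + complex.Re (G p).
    by apply/funext => p; case: (F p) (G p) => ? ? [].
  exact: measurable_funD.
have -> : (fun p => complex.Im (F p + G p)) = fun p => complex.Im (F p) + complex.Im (G p).
  by apply/funext => p; case: (F p) (G p) => ? ? [].
exact: measurable_funD.
Qed.

Lemma cmeasurable_sum N (F : nat -> T -> C) : (forall k, cmeasurable (F k)) ->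
  cmeasurable (fun p => \sum_(k < N) F k p).
Proof.
move=> mF; elim: N => [|N IH].
  by under eq_fun do rewrite big_ord0; exact: cmeasurable_cst.
by under eq_fun do rewrite big_ord_recr/=; exact: cmeasurableD.
Qed.

Lemma cmeasurableX F n : cmeasurable F -> cmeasurable (fun p => F p ^+ n).
Proof.
move=> mF; elim: n => [|n IH].
  by under eq_fun do rewrite expr0; exact: cmeasurable_cst.
by under eq_fun do rewrite exprS; exact: cmeasurableM.
Qed.

Lemma cmeasurable_conj F : cmeasurable F -> cmeasurable (fun p => (F p)^*%C).
Proof.
move=> [F1 F2]; split.
  have -> // : (fun p => complex.Re (F p)^*%C) = fun p => complex.Re (F p).
  by apply/funext => p; case: (F p).
have -> : (fun p => complex.Im (F p)^*%C) = fun p => - complex.Im (F p).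
  by apply/funext => p; case: (F p).
exact: measurable_funN.
Qed.

Lemma cmeasurable_cvg (F : nat -> T -> C) G : (forall n, cmeasurable (F n)) ->
  (forall p, D p -> cvgc (fun n => F n p) (G p)) -> cmeasurable G.
Proof.
move=> mF FG; split.
  apply: (@measurable_fun_cvg _ _ _ _ (fun n p => complex.Re (F n p))).
    by move=> n; have [] := mF n.
  move=> p Dp; apply/cvgrPdist_le => e e0; have [N hN] := FG p Dp e e0.
  by exists N => // n /hN h; rewrite -ReB; apply: le_trans (normc_ge_Re _) _; rewrite normcB.
apply: (@measurable_fun_cvg _ _ _ _ (fun n p => complex.Im (F n p))).
  by move=> n; have [] := mF n.
move=> p Dp; apply/cvgrPdist_le => e e0; have [N hN] := FG p Dp e e0.
by exists N => // n /hN h; rewrite -ImB; apply: le_trans (normc_ge_Im _) _; rewrite normcB.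
Qed.

Lemma measurable_normc2 F : cmeasurable F -> measurable_fun D (fun p => normc (F p) ^+ 2).
Proof.
move=> [F1 F2].
have -> : (fun p => normc (F p) ^+ 2) =
    fun p => complex.Re (F p) * complex.Re (F p) + complex.Im (F p) * complex.Im (F p).
  apply/funext => p; case: (F p) => x y /=.
  by rewrite sqr_sqrtr ?addr_ge0 ?sqr_ge0// !expr2.
by apply: measurable_funD; exact: measurable_funM.
Qed.

Lemma integrable_dominated (f g : T -> R) : measurable_fun D f ->
  mu.-integrable D (EFin \o g) -> (forall p, D p -> `|f p| <= g p) ->
  mu.-integrable D (fun p => (f p)%:E).
Proof.
move=> mf ig fg; apply: (le_integrable mD _ _ ig).
  exact/measurable_EFinP.
move=> p Dp /=; rewrite lee_fin; apply: le_trans (fg p Dp) _; exact: ler_norm.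
Qed.

Lemma cintegrable_dominated F g : cmeasurable F -> mu.-integrable D (EFin \o g) ->
  (forall p, D p -> normc (F p) <= g p) -> cintegrable F.
Proof.
move=> [F1 F2] ig Fg; split; apply: (integrable_dominated _ ig) => // p Dp.
  exact: le_trans (normc_ge_Re _) (Fg p Dp).
exact: le_trans (normc_ge_Im _) (Fg p Dp).
Qed.

Lemma cintZ (x : C) F : cintegrable F -> cint (fun p => x * F p) = x * cint F.
Proof.
move=> [F1 F2]; case: x => x y; rewrite /cint.
have iZ (u : R) (f : T -> R) : mu.-integrable D (EFin \o f) ->
    mu.-integrable D (EFin \o (fun p => u * f p)).
  move=> h; have := integrableZl mD u h; apply: eq_integrable => // p _.
have -> : \int[mu]_(p in D) complex.Re (Complex x y * F p) =
    \int[mu]_(p in D) (x * complex.Re (F p) - y * complex.Im (F p)).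
  by apply: eq_Rintegral => p _; rewrite ReM.
have -> : \int[mu]_(p in D) complex.Im (Complex x y * F p) =
    \int[mu]_(p in D) (x * complex.Im (F p) + y * complex.Re (F p)).
  by apply: eq_Rintegral => p _; rewrite ImM.
rewrite (RintegralB mD (iZ _ _ F1) (iZ _ _ F2)) (RintegralD mD (iZ _ _ F2) (iZ _ _ F1)).
by rewrite !RintegralZl.
Qed.

Lemma cintD F G : cintegrable F -> cintegrable G ->
  cint (fun p => F p + G p) = cint F + cint G.
Proof.
move=> [F1 F2] [G1 G2]; rewrite /cint.
have -> : \int[mu]_(p in D) complex.Re (F p + G p) =
    \int[mu]_(p in D) (complex.Re (F p) + complex.Re (G p)).
  by apply: eq_Rintegral => p _; case: (F p) (G p) => ? ? [].
have -> : \int[mu]_(p in D) complex.Im (F p + G p) =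
    \int[mu]_(p in D) (complex.Im (F p) + complex.Im (G p)).
  by apply: eq_Rintegral => p _; case: (F p) (G p) => ? ? [].
by rewrite !RintegralD.
Qed.

Lemma eq_cint F G : (forall p, D p -> F p = G p) -> cint F = cint G.
Proof.
by move=> FG; rewrite /cint; congr Complex; apply: eq_Rintegral => p /set_mem /FG ->.
Qed.

Lemma cint0 : cint (fun=> 0) = 0.
Proof. by rewrite /cint/= /Rintegral integral0. Qed.

Lemma dominated_Rintegral (f_ : nat -> T -> R) (f g : T -> R) :
  (forall n, measurable_fun D (f_ n)) -> measurable_fun D f ->
  mu.-integrable D (EFin \o g) ->
  (forall p, D p -> f_ ^~ p @ \oo --> f p) ->
  (forall n p, D p -> `|f_ n p| <= g p) ->
  \int[mu]_(p in D) f_ n p @[n --> \oo] --> \int[mu]_(p in D) f p.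
Proof.
move=> mf_ mf ig ff fg.
have mE n : measurable_fun D (fun p => (f_ n p)%:E) by exact/measurable_EFinP.
have mE' : measurable_fun D (fun p => (f p)%:E) by exact/measurable_EFinP.
have [||i1 _ cv] := @dominated_convergence _ _ _ mu D mD (fun n p => (f_ n p)%:E)
  (fun p => (f p)%:E) (EFin \o g) mE mE' _ ig.
- apply: aeW => p Dp; apply: cvg_EFin; first exact: nearW.
  exact: ff.
- by apply: aeW => p n Dp; rewrite /= lee_fin fg.
have fin := integrable_fin_num mD i1.
apply: (@fine_cvg _ _ _ _ (fun n => \int[mu]_(p in D) (f_ n p)%:E)%E).
by rewrite fineK.
Qed.

Lemma cint_dominated (F : nat -> T -> C) G g :
  (forall n, cmeasurable (F n)) -> cmeasurable G -> mu.-integrable D (EFin \o g) ->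
  (forall p, D p -> cvgc (fun n => F n p) (G p)) ->
  (forall n p, D p -> normc (F n p) <= g p) ->
  cvgc (fun n => cint (F n)) (cint G).
Proof.
move=> mF [G1 G2] ig FG Fg.
have cRe : \int[mu]_(p in D) complex.Re (F n p) @[n --> \oo] --> \int[mu]_(p in D) complex.Re (G p).
  apply: (dominated_Rintegral _ G1 ig).
  - by move=> n; have [] := mF n.
  - move=> p Dp; apply/cvgrPdist_le => e e0; have [N hN] := FG p Dp e e0.
    by exists N => // n /hN h; rewrite -ReB; apply: le_trans (normc_ge_Re _) _; rewrite normcB.
  - by move=> n p Dp; exact: le_trans (normc_ge_Re _) (Fg n p Dp).
have cIm : \int[mu]_(p in D) complex.Im (F n p) @[n --> \oo] --> \int[mu]_(p in D) complex.Im (G p).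
  apply: (dominated_Rintegral _ G2 ig).
  - by move=> n; have [] := mF n.
  - move=> p Dp; apply/cvgrPdist_le => e e0; have [N hN] := FG p Dp e e0.
    by exists N => // n /hN h; rewrite -ImB; apply: le_trans (normc_ge_Im _) _; rewrite normcB.
  - by move=> n p Dp; exact: le_trans (normc_ge_Im _) (Fg n p Dp).
move=> e e0; have e2 : 0 < e / 2 by rewrite divr_gt0.
move/cvgrPdist_le : cRe => /(_ _ e2)[N1 _ h1].
move/cvgrPdist_le : cIm => /(_ _ e2)[N2 _ h2].
exists (maxn N1 N2) => n; rewrite geq_max => /andP[n1 n2].
apply: (le_trans (normc_le_ReIm _)); rewrite ReB ImB [leRHS]splitr.
by apply: lerD; rewrite distrC; [exact: h1|exact: h2].
Qed.

End complex_integral.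

(** * Radial weights and reproducing kernels *)

Section radial_weight.
Context d (T : measurableType d) (R : realType) (mu : {measure set T -> \bar R}).
Local Notation C := R[i].
Variables (Z : T -> C) (W : T -> R).
Let D := [set p | normc (Z p) < 1].
Hypothesis mZ : cmeasurable setT Z.
Hypothesis W_ge0 : forall p, D p -> 0 <= W p.
Hypothesis iW : mu.-integrable D (EFin \o W).
Hypothesis rotationZ : forall c s : R, c ^+ 2 + s ^+ 2 = 1 -> c != -1 ->
  exists f : T -> T, [/\ measurable_fun setT f,
    forall A, measurable A -> mu (f @^-1` A) = mu A,
    forall p, Z (f p) = Complex c s * Z p &
    forall p, D p -> W (f p) = W p].

Lemma measurable_disk_preimage (r : R) : 0 < r -> measurable [set p | normc (Z p) < r].
Proof.
move=> r0.
have -> : [set p | normc (Z p) < r] =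
    setT `&` (fun p => normc (Z p) ^+ 2) @^-1` [set` `]-oo, r ^+ 2[].
  rewrite setTI; apply/seteqP; split=> p /=; rewrite in_itv/=.
    by move=> h; rewrite ltr_pXn2r// nnegrE ?normc_ge0// ltW.
  by rewrite ltr_pXn2r// nnegrE ?normc_ge0// ltW.
exact: (measurable_normc2 mZ) measurableT _ (measurable_itv _).
Qed.

Let mD : measurable D. Proof. exact: measurable_disk_preimage. Qed.

Let mZD : cmeasurable D Z.
Proof. by case: mZ => Z1 Z2; split; exact: measurable_funTS. Qed.

Let mW : measurable_fun D W.
Proof. by apply/measurable_EFinP; case/integrableP: iW. Qed.

Lemma normc_conjc (z : C) : normc z^*%C = normc z.
Proof. by case: z => x y /=; rewrite sqrrN. Qed.

(** On |Z| < r < 1 the partial sums of a kernel are uniformly bounded, so dominated convergence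
    allows termwise integration there. *)
Definition truncated_weight (r : R) (p : T) : R := W p * \1_[set p | normc (Z p) < r] p.

Lemma truncated_weight_lt r p : normc (Z p) < r -> truncated_weight r p = W p.
Proof. by move=> h; rewrite /truncated_weight indicE mem_set// mulr1. Qed.

Lemma truncated_weight_ge r p : r <= normc (Z p) -> truncated_weight r p = 0.
Proof.
by move=> h; rewrite /truncated_weight indicE memNset ?mulr0//= => /(le_lt_trans h); rewrite ltxx.
Qed.

Lemma truncated_weight_ge0 r p : D p -> 0 <= truncated_weight r p.
Proof. by move=> Dp; rewrite mulr_ge0 ?W_ge0// indicE. Qed.

Lemma truncated_weight_le r p : D p -> truncated_weight r p <= W p.
Proof. by move=> Dp; rewrite ler_piMr ?W_ge0// indicE lern1 leq_b1. Qed.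

Lemma measurable_truncated_weight r : 0 < r -> measurable_fun D (truncated_weight r).
Proof.
move=> r0; apply: measurable_funM => //.
exact: measurable_indic (measurable_disk_preimage r0).
Qed.

Definition moment_integrand (r : R) (n k : nat) (p : T) : C :=
  Z p ^+ n * (Z p)^*%C ^+ k * (truncated_weight r p)%:C%C.

Lemma cmeasurable_moment_integrand r n k : 0 < r -> cmeasurable D (moment_integrand r n k).
Proof.
move=> r0; apply: cmeasurableM.
  apply: cmeasurableM; first exact: cmeasurableX.
  exact: cmeasurableX (cmeasurable_conj mZD).
exact: cmeasurable_real (measurable_truncated_weight r0).
Qed.

Lemma moment_integrand_le r n k p : D p -> normc (moment_integrand r n k p) <= W p.
Proof.
move=> Dp; rewrite !normcM !normcX normc_conjc normc_real (ger0_norm (truncated_weight_ge0 _ Dp)).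
rewrite -exprD -[leRHS]mul1r; apply: ler_pM.
- by rewrite exprn_ge0 ?normc_ge0.
- exact: truncated_weight_ge0.
- by rewrite exprn_ile1 ?normc_ge0// ltW.
- exact: truncated_weight_le.
Qed.

Lemma cintegrable_moment_integrand r n k : 0 < r -> cintegrable mu D (moment_integrand r n k).
Proof.
move=> r0; apply: (cintegrable_dominated mD (cmeasurable_moment_integrand n k r0) iW).
by move=> p; exact: moment_integrand_le.
Qed.

(* A rotation by a root of unity of large order multiplies the integral by a
   number different from [1]. *)
Lemma moment_orthogonal r n k : 0 < r -> n != k -> cint mu D (moment_integrand r n k) = 0.
Proof.
move=> r0 nk.
(* Both n and k are below N, so z ^ n and z ^ k differ. *)
pose m := (maxn n k).+1; have [z zN] := exists_dyadic_primitive_root R m.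
set N := (2 ^ m.+1)%N in zN.
have mN : (m < N)%N.
  by apply: (leq_trans (ltn_expl m (isT : 1 < 2)%N)); rewrite /N leq_exp2l.
have nz : normc z = 1 by apply: normc_dyadic_root; exists m.+1; exact: prim_expr_order.
have [c [s zE]] : exists c s, z = Complex c s by case: (z) => c s; exists c, s.
have cs1 : c ^+ 2 + s ^+ 2 = 1.
  have : normc z ^+ 2 = 1 by rewrite nz expr1n.
  by rewrite zE /= sqr_sqrtr ?addr_ge0 ?sqr_ge0.
(* z = -1 would have order dividing 2, but N > m >= 2, since n and k are not both 0. *)
have c1 : c != -1.
  apply/eqP => cE; have s0 : s = 0.
    by move: cs1; rewrite cE sqrrN expr1n => /eqP; rewrite -subr_eq0 addrAC subrr add0r sqrf_eq0 => /eqP.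
  have : z ^+ 2 = 1.
    have -> : z = -1 by rewrite zE cE s0; apply/eqP; rewrite eq_complex/= oppr0 !eqxx.
    by rewrite sqrrN expr1n.
  move/eqP; rewrite -(prim_order_dvd zN) => /(dvdn_leq (isT : 0 < 2)%N).
  rewrite leqNgt (leq_ltn_trans _ mN)// /m ltnS leq_max.
  by case: (n) (k) nk => [|n'] [].
have [f [mf fmu fZ fW]] := rotationZ cs1 c1.
have DE : f @^-1` D = D.
  by apply/seteqP; split=> p; rewrite /D/= fZ -zE normcM nz mul1r.
set G := moment_integrand r n k.
have [mG1 mG2] := cmeasurable_moment_integrand n k r0.
have I : cint mu D G = cint mu D (fun p => G (f p)).
  rewrite /cint /Rintegral; congr Complex; congr fine.
    by rewrite -(integral_measure_preserving mf fmu mD DE)//; exact/measurable_EFinP.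
  by rewrite -(integral_measure_preserving mf fmu mD DE)//; exact/measurable_EFinP.
have GE p : D p -> G (f p) = (z ^+ n * z^*%C ^+ k) * G p.
  move=> Dp; rewrite /G /moment_integrand.
  have -> : truncated_weight r (f p) = truncated_weight r p.
    rewrite /truncated_weight fW// !indicE; congr (_ * (_ : bool)%:R).
    by apply/idP/idP => /set_mem h; apply/mem_set; move: h => /=; rewrite fZ -zE normcM nz mul1r.
  by rewrite fZ -zE rmorphM !exprMn; ring.
have II : cint mu D G = (z ^+ n * z^*%C ^+ k) * cint mu D G.
  rewrite {1}I (eq_cint mu GE) cintZ//; exact: cintegrable_moment_integrand.
apply/eqP; have /eqP : (1 - z ^+ n * z^*%C ^+ k) * cint mu D G = 0.
  by rewrite mulrBl mul1r -II subrr.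
rewrite mulf_eq0 => /orP[|//]; rewrite subr_eq0 => /eqP E.
have zz : z * z^*%C = 1.
  by rewrite -sqr_normc normcEc nz rmorph1 expr1n.
have : z ^+ n = z ^+ k.
  by rewrite -[RHS]mulr1 E mulrCA -exprMn zz expr1n mulr1.
move/eqP; rewrite (eq_prim_root_expr zN).
rewrite !modn_small; first by rewrite (negbTE nk).
  by apply: leq_ltn_trans mN; rewrite leqW// leq_maxr.
by apply: leq_ltn_trans mN; rewrite leqW// leq_maxl.
Qed.

Lemma cvgc_conjc (u : nat -> C) l : cvgc u l -> cvgc (fun n => (u n)^*%C) (l^*%C).
Proof.
by move=> ul e /ul[N hN]; exists N => n /hN; rewrite -rmorphB normc_conjc.
Qed.

Variable c : nat -> C.
Hypothesis hc : disk_coefs c.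

Let psum_cvg_Z p : D p -> cvgc (fun N => \sum_(k < N) c k * Z p ^+ k) (psum c (Z p)).
Proof.
move=> Dp; have z0 := normc_ge0 (Z p); have z1 : normc (Z p) < 1 := Dp.
have [|M hM] := hc (t := (1 + normc (Z p)) / 2); first by apply/andP; split; lra.
by apply: psum_cvg hM _; lra.
Qed.

Lemma cmeasurable_psum : cmeasurable D (fun p => psum c (Z p)).
Proof.
apply: (cmeasurable_cvg _ psum_cvg_Z) => N.
apply: (cmeasurable_sum _ (F := fun k p => c k * Z p ^+ k)) => k.
by apply: cmeasurableM; [exact: cmeasurable_cst|exact: cmeasurableX].
Qed.

Let cmeasurable_pairing n (V : T -> R) : measurable_fun D V ->
  cmeasurable D (fun p => Z p ^+ n * (psum c (Z p))^*%C * (V p)%:C%C).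
Proof.
move=> mV; apply: cmeasurableM; last exact: cmeasurable_real.
apply: cmeasurableM; first exact: cmeasurableX.
exact: cmeasurable_conj cmeasurable_psum.
Qed.

Lemma truncated_pairing r n : 0 < r < 1 ->
  cint mu D (fun p => Z p ^+ n * (psum c (Z p))^*%C * (truncated_weight r p)%:C%C) =
  (c n)^*%C * cint mu D (moment_integrand r n n).
Proof.
move=> /andP[r0 r1].
have [|M hM] := hc (t := (1 + r) / 2); first by apply/andP; split; lra.
set s := (1 + r) / 2 in hM; have rs : r < s by rewrite /s; lra.
have s0 : 0 < s by exact: lt_trans rs.
have M0 := coef_bound_ge0 hM.
have q01 := ratio01 (ltW r0) rs.
have q10 : 0 < 1 - r / s by case/andP: q01 => _; rewrite subr_gt0.
pose F N p := \sum_(k < N) (c k)^*%C * moment_integrand r n k p.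
have FE N p : F N p = Z p ^+ n * (\sum_(k < N) c k * Z p ^+ k)^*%C * (truncated_weight r p)%:C%C.
  rewrite rmorph_sum mulr_sumr mulr_suml; apply: eq_bigr => k _.
  by rewrite /moment_integrand rmorphM/= -(rmorphXn (@conjc R)); ring.
have mF N : cmeasurable D (F N).
  apply: (cmeasurable_sum _ (F := fun k p => (c k)^*%C * moment_integrand r n k p)) => k.
  by apply: cmeasurableM; [exact: cmeasurable_cst|exact: cmeasurable_moment_integrand].
(* The sum of the geometric series dominating |c_k| |Z| ^ k on |Z| < r. *)
pose K := M / (1 - r / s).
have K0 : 0 <= K by rewrite divr_ge0// ltW.
have iKW : mu.-integrable D (EFin \o (fun p => K * W p)).
  have := integrableZl mD K iW; apply: eq_integrable => // p _.
have FK N p : D p -> normc (F N p) <= K * W p.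
  move=> Dp; rewrite FE !normcM normcX normc_conjc normc_real (ger0_norm (truncated_weight_ge0 _ Dp)).
  have [zr|rz] := ltP (normc (Z p)) r; last first.
    by rewrite truncated_weight_ge// mulr0 mulr_ge0 ?W_ge0.
  rewrite truncated_weight_lt// ler_wpM2r ?W_ge0//.
  rewrite -[leRHS]mul1r; apply: ler_pM; rewrite ?exprn_ge0 ?normc_ge0//.
    by rewrite exprn_ile1 ?normc_ge0// ltW.
  apply: (le_trans (normc_sum _ _ _)).
  apply: (@le_trans _ _ (\sum_(k < N) M * (r / s) ^+ k)).
    apply: ler_sum => k _; rewrite normcM normcX.
    apply: le_trans (coef_term_le s0 (ltW r0) hM k).
    by rewrite ler_wpM2l ?normc_ge0// lerXn2r ?nnegrE ?normc_ge0// ltW.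
  rewrite -mulr_sumr /K ler_wpM2l//.
  by have := @geo_tail_le R (r / s) 0 N q01; rewrite expr0 div1r.
have cv : cvgc (fun N => cint mu D (F N))
    (cint mu D (fun p => Z p ^+ n * (psum c (Z p))^*%C * (truncated_weight r p)%:C%C)).
  apply: (cint_dominated mD mF _ iKW _ FK).
    exact: cmeasurable_pairing (measurable_truncated_weight r0).
  move=> p Dp; under eq_fun do rewrite FE.
  apply: cvgcZ; under eq_fun do rewrite mulrC.
  by rewrite mulrC; apply: cvgcZ; apply: cvgc_conjc; exact: psum_cvg_Z.
have FI N : cint mu D (F N) = \sum_(k < N) (c k)^*%C * cint mu D (moment_integrand r n k).
  have iM k : cintegrable mu D (fun p => (c k)^*%C * moment_integrand r n k p).
    apply: (@cintegrable_dominated _ _ _ mu D mD _ (fun p => normc (c k) * W p)).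
    - by apply: cmeasurableM; [exact: cmeasurable_cst|exact: cmeasurable_moment_integrand].
    - have := integrableZl mD (normc (c k)) iW; apply: eq_integrable => // p _.
    - move=> p Dp; rewrite normcM normc_conjc ler_wpM2l ?normc_ge0//.
      exact: moment_integrand_le.
  have iF : cintegrable mu D (F N).
    exact: (@cintegrable_dominated _ _ _ mu D mD (F N) (fun p => K * W p) (mF N) iKW (FK N)).
  elim: N {iF} => [|N IH].
    rewrite big_ord0 -[RHS](cint0 mu D); apply: eq_cint => p _.
    by rewrite /F big_ord0.
  rewrite big_ord_recr/= -IH -cintZ//; last exact: cintegrable_moment_integrand.
  rewrite -cintD//; last exact: (@cintegrable_dominated _ _ _ mu D mD (F N) (fun p => K * W p) (mF N) iKW (FK N)).
  by apply: eq_cint => p _; rewrite /F big_ord_recr.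
(* By orthogonality only k = n survives, so the integrals are constant as soon as N > n. *)
apply: cvgc_unique cv _ => e e0; exists n.+1 => N nN.
rewrite FI (bigD1 (Ordinal nN))//= big1 ?addr0 ?subrr ?normc0 ?ltW// => k kn.
by rewrite moment_orthogonal ?mulr0// eq_sym; apply: contra kn.
Qed.

Definition moment n : R := \int[mu]_(p in D) (normc (Z p) ^+ n.*2 * W p).

Let moment_term_ge0 n p : D p -> 0 <= normc (Z p) ^+ n.*2 * W p.
Proof. by move=> Dp; rewrite mulr_ge0 ?exprn_ge0 ?normc_ge0 ?W_ge0. Qed.

Let moment_term_le n p : D p -> normc (Z p) ^+ n.*2 * W p <= W p.
Proof.
by move=> Dp; rewrite ler_piMl ?W_ge0// exprn_ile1 ?normc_ge0// ltW.
Qed.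

Lemma integrable_moment_term n : mu.-integrable D (EFin \o (fun p => normc (Z p) ^+ n.*2 * W p)).
Proof.
apply: (integrable_dominated mD _ iW).
  apply: measurable_funM => //.
  under eq_fun do rewrite -mul2n exprM.
  apply: (measurable_funX n); exact: (measurable_normc2 mZD).
by move=> p Dp; rewrite ger0_norm ?moment_term_ge0// moment_term_le.
Qed.

Lemma moment_ge0 n : 0 <= moment n.
Proof. by apply: Rintegral_ge0 => p Dp; exact: moment_term_ge0. Qed.

Lemma moment_le n : moment n <= moment 0.
Proof.
apply: le_Rintegral => //; [exact: integrable_moment_term..|move=> p Dp].
by rewrite expr0 mul1r; exact: moment_term_le.
Qed.

Hypothesis ic : mu.-integrable D (fun p => (normc (psum c (Z p)) ^+ 2 * W p)%:E).

Lemma pairing_moment n :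
  cint mu D (fun p => Z p ^+ n * (psum c (Z p))^*%C * (W p)%:C%C) =
  (c n)^*%C * (moment n)%:C%C.
Proof.
(* The radii increase to 1; the shift by 2 keeps the first one positive. *)
pose r j : R := 1 - j.+2%:R^-1.
have r0 j : 0 < r j by rewrite subr_gt0 invf_lt1// ltr1n.
have r1 j : r j < 1 by rewrite gtrBl invr_gt0.
have tw_cvg p (x : C) : D p -> cvgc (fun j => x * (truncated_weight (r j) p)%:C%C) (x * (W p)%:C%C).
  move=> Dp e e0; have z1 : 0 < 1 - normc (Z p) by rewrite subr_gt0.
  exists (Num.truncn (1 - normc (Z p))^-1) => j hj.
  rewrite truncated_weight_lt ?subrr ?normc0 ?ltW// ltrBrDl -ltrBrDr.
  rewrite -[ltRHS]invrK ltf_pV2 ?posrE ?invr_gt0//.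
  by apply: (lt_le_trans (truncnS_gt _)); rewrite ler_nat ltnS leqW.
(* This dominates the integrand because |Z| < 1 and x <= 1 + x ^ 2. *)
have iG : mu.-integrable D (EFin \o (fun p => W p + normc (psum c (Z p)) ^+ 2 * W p)).
  exact: (integrableD mD iW ic).
have cv1 : cvgc (fun j => cint mu D (fun p => Z p ^+ n * (psum c (Z p))^*%C *
      (truncated_weight (r j) p)%:C%C))
    (cint mu D (fun p => Z p ^+ n * (psum c (Z p))^*%C * (W p)%:C%C)).
  apply: (cint_dominated mD _ _ iG).
  - by move=> j; exact: cmeasurable_pairing (measurable_truncated_weight (r0 j)).
  - exact: cmeasurable_pairing.
  - by move=> p Dp; exact: tw_cvg.
  move=> j p Dp; rewrite !normcM normcX normc_conjc normc_real (ger0_norm (truncated_weight_ge0 _ Dp)).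
  have -> : W p + normc (psum c (Z p)) ^+ 2 * W p = (1 + normc (psum c (Z p)) ^+ 2) * W p by ring.
  apply: ler_pM.
  - by rewrite mulr_ge0 ?exprn_ge0 ?normc_ge0.
  - exact: truncated_weight_ge0.
  - set x := normc (psum _ _); have x0 : 0 <= x by exact: normc_ge0.
    apply: (@le_trans _ _ x); last by nra.
    by rewrite ler_piMl// exprn_ile1 ?normc_ge0// ltW.
  - exact: truncated_weight_le.
have cv2 : cvgc (fun j => cint mu D (moment_integrand (r j) n n))
    (cint mu D (fun p => Z p ^+ n * (Z p)^*%C ^+ n * (W p)%:C%C)).
  apply: (cint_dominated (F := fun j => moment_integrand (r j) n n) mD _ _ iW).
  - by move=> j; exact: cmeasurable_moment_integrand.
  - apply: cmeasurableM; last exact: cmeasurable_real.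
    apply: cmeasurableM; first exact: cmeasurableX.
    exact: cmeasurableX (cmeasurable_conj mZD).
  - by move=> p Dp; exact: tw_cvg.
  - by move=> j p; exact: moment_integrand_le.
have -> : (moment n)%:C%C = cint mu D (fun p => Z p ^+ n * (Z p)^*%C ^+ n * (W p)%:C%C).
  rewrite (eq_cint mu (G := fun p => ((normc (Z p) ^+ n.*2 * W p)%:C)%C)).
    by rewrite /cint/= /moment [X in Complex _ X]/Rintegral integral0.
  move=> p _; rewrite -exprMn -sqr_normc normcEc -exprM mul2n.
  by rewrite rmorphM rmorphXn.
apply: cvgc_unique cv1 _.
have := cvgcZ (c n)^*%C cv2; rewrite mulrC; congr cvgc; apply/funext => j.
by rewrite truncated_pairing ?r0 ?r1// mulrC.
Qed.

End radial_weight.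

(** * Coefficients of the reproducing kernels *)

Section kernel.
Variable R : realType.
Local Notation C := R[i].
Variables (w : C -> R) (B : disk R -> hol R).
Hypotheses (w_weight : is_weight w) (w_radial : is_radial w).
Hypothesis B_kernel : reproducing_kernel w B.

Let plane : measurableType _ :=
  caratheodory_type (mu_ext (@lebesgue_measure R \x @lebesgue_measure R)%E).
Let Z (p : plane) : C := cplx p.
Let W (p : plane) : R := w (cplx p).

Lemma plane_diskE : plane_disk R = [set p | normc (Z p) < 1].
Proof. by apply/seteqP; split => p; rewrite /plane_disk /disk/= ltcR. Qed.

Lemma measurable_cplx : cmeasurable [set: plane] Z.
Proof.
split.
  move=> _ A mA; rewrite setTI; apply: caratheodory_measurable_mu_ext.
  rewrite -[X in measurable X]setTI.
  exact: (@measurable_fst _ _ (measurableTypeR R) (measurableTypeR R)) measurableT _ mA.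
move=> _ A mA; rewrite setTI; apply: caratheodory_measurable_mu_ext.
rewrite -[X in measurable X]setTI.
exact: (@measurable_snd _ _ (measurableTypeR R) (measurableTypeR R)) measurableT _ mA.
Qed.

Lemma cplx_rotation (c s : R) (p : R * R) :
  cplx (rotation c s p) = Complex c s * cplx p :> C.
Proof. by apply/eqP; rewrite eq_complex/=; apply/andP; split; apply/eqP; ring. Qed.

Lemma weight_rotation (c s : R) : c ^+ 2 + s ^+ 2 = 1 -> c != -1 ->
  exists f : plane -> plane, [/\ measurable_fun setT f,
    forall A, measurable A -> area_measure R (f @^-1` A) = area_measure R A,
    forall p, Z (f p) = Complex c s * Z p &
    forall p, normc (Z p) < 1 -> W (f p) = W p].
Proof.
move=> cs1 c1; exists (rotation c s); split.
- exact: measurable_planar_rotation.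
- by move=> A _; exact: area_preimage_rotation.
- by move=> p; exact: cplx_rotation.
move=> p p1; rewrite /W.
have E := cplx_rotation c s p.
have n1 : normc (Complex c s) = 1 by rewrite /= cs1 sqrtr1.
have d1 : disk R (cplx p) by rewrite /disk/= ltcR.
have d2 : disk R (cplx (rotation c s p)).
  rewrite /disk /mkset E normcEc ltcR normcM n1 mul1r; exact: p1.
by rewrite (w_radial d1) (w_radial d2) E normrM normcEc n1 mul1r.
Qed.

Lemma plane_extE (f : hol R) (p : plane) : normc (Z p) < 1 -> plane_ext f p = psum (coef f) (Z p).
Proof.
move=> p1; have E : psum (coef f) (Z p) = psum (coef f) (val (to_disk p1)) by [].
by rewrite E -coefE -hol_ext_val.
Qed.

Lemma kernel_moments : exists m : nat -> R,
  (forall n, 0 <= m n <= m 0) /\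
  forall (z : disk R) n, (val z : C) ^+ n = (coef (B z) n)^*%C * (m n)%:C%C.
Proof.
have W0 (p : plane) : [set p | normc (Z p) < 1] p -> 0 <= W p.
  by rewrite -plane_diskE => Dp; apply: (w_weight.1).
have iW : (area_measure R).-integrable [set p | normc (Z p) < 1] (EFin \o W).
  by rewrite -plane_diskE; exact: w_weight.2.
have rotZ (c s : R) : c ^+ 2 + s ^+ 2 = 1 -> c != -1 ->
  exists f : plane -> plane, [/\ measurable_fun setT f,
    forall A, measurable A -> area_measure R (f @^-1` A) = area_measure R A,
    forall p, Z (f p) = Complex c s * Z p &
    forall p, [set p | normc (Z p) < 1] p -> W (f p) = W p] := @weight_rotation c s.
exists (moment (area_measure R) Z W); split=> [n|z n].
  by rewrite (moment_ge0 (area_measure R) W0) (moment_le measurable_cplx W0 iW).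
have [B_bergman B_repr] := B_kernel.
(* |Z| ^ (2 n) W <= W on the disk, so the integrability of the weight suffices. *)
have mem_mono : bergman_space w (monomial R n).
  rewrite /bergman_space plane_diskE.
  have := integrable_moment_term measurable_cplx W0 iW n.
  apply: eq_integrable => [|p /set_mem pD]; first exact: measurable_disk_preimage measurable_cplx _ _.
  have -> : plane_ext (monomial R n) p = Z p ^+ n.
    by rewrite (plane_extE _ pD) -(monomialE n (to_disk pD)) coefE.
  by rewrite normcEc normcX -exprM muln2.
have /= := B_repr (monomial R n) z mem_mono.
rewrite monomialE => ->.
have ic : (area_measure R).-integrable [set p | normc (Z p) < 1]
    (fun p => (normc (psum (coef (B z)) (Z p)) ^+ 2 * W p)%:E).
  have := B_bergman z; rewrite /bergman_space plane_diskE.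
  by apply: eq_integrable => [|p /set_mem pD];
    [exact: measurable_disk_preimage measurable_cplx _ _|rewrite (plane_extE _ pD)].
rewrite -(pairing_moment measurable_cplx W0 iW rotZ (@coef_disk_coefs _ (B z)) ic n).
rewrite /area_cintegral plane_diskE -/(cint _ _ _).
apply: eq_cint => p pD; rewrite !(plane_extE _ pD).
have -> : psum (coef (monomial R n)) (Z p) = monomial R n (to_disk pD) by rewrite coefE.
by rewrite monomialE.
Qed.

Lemma kernel_coef : exists m : nat -> R,
  (forall n, 0 < m n <= m 0) /\
  forall (z : disk R) n, coef (B z) n = (val z : C)^*%C ^+ n / (m n)%:C%C.
Proof.
have [m [m0 mE]] := kernel_moments.
have h1 : normc ((2^-1 : R)%:C%C : C) < 1 by rewrite normc_real gtr0_norm; lra.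
(* At z = 1/2 the left-hand side z ^ n of [mE] is not 0. *)
have m_neq0 n : m n != 0.
  apply/eqP => mn; have := mE (to_disk h1) n; rewrite mn mulr0 => /eqP.
  by rewrite expf_eq0 => /andP[_ /eqP] /complexI/eqP; rewrite invr_eq0 pnatr_eq0.
exists m; split=> [n|z n]; first by have /andP[? ->] := m0 n; rewrite lt_def m_neq0 andbT.
have mC : (m n)%:C%C != 0 :> C by rewrite -(rmorph0 (real_complex R)) (inj_eq (@complexI R)).
have -> : (val z : C)^*%C ^+ n = ((val z : C) ^+ n)^*%C by rewrite -(rmorphXn (@conjc R)).
rewrite mE.
have -> : ((coef (B z) n)^*%C * (m n)%:C%C)^*%C = coef (B z) n * (m n)%:C%C.
  by rewrite rmorphM; congr (_ * _); [exact: conjcK|exact: conjc_real].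
by rewrite mulfK.
Qed.

End kernel.

(** * Existence and uniqueness of the operator *)

Lemma kernel_multiplier_disk_coefs (R : realType) (B : disk R -> hol R) (m m' : nat -> R) :
  (forall n, 0 < m n <= m 0) -> (forall n, 0 < m' n) ->
  (forall (z : disk R) n, coef (B z) n = (val z : R[i])^*%C ^+ n / (m' n)%:C%C) ->
  disk_coefs (fun n => (m n / m' n)%:C%C).
Proof.
move=> m0 m'0 BE t /andP[t0 t1].
(* t <= u ^ 2 by the inequality of arithmetic and geometric means, and the coefficient bound at
   radius u for the kernel at the point u controls u ^ (2 n) / m' n. *)
pose u := (1 + t) / 2.
have u0 : 0 < u by rewrite /u; lra.
have u1 : u < 1 by rewrite /u; lra.
have nu : normc (u%:C%C : R[i]) < 1 by rewrite normc_real gtr0_norm.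
have [|M hM] := @coef_disk_coefs _ (B (to_disk nu)) u; first by rewrite u1 ltW.
exists (m 0 * M) => n.
have /andP[mn mn0] := m0 n.
have : t ^+ n / m' n <= M.
  apply: le_trans (hM n); rewrite BE.
  have -> : (val (to_disk nu) : R[i])^*%C ^+ n / (m' n)%:C%C = (u ^+ n / m' n)%:C%C.
    by rewrite /= oppr0 rmorphM/= rmorphXn fmorphV.
  have un : 0 <= u ^+ n by rewrite exprn_ge0// ltW.
  rewrite normc_real ger0_norm ?divr_ge0 ?(ltW (m'0 n))//.
  rewrite mulrAC ler_pM2r ?invr_gt0// -exprMn.
  have tu : t <= u * u by rewrite /u; nra.
  by apply: lerXn2r => //; rewrite nnegrE// (le_trans t0).
have N : normc ((m n / m' n)%:C%C : R[i]) = m n / m' n.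
  by rewrite normc_real ger0_norm// divr_ge0 ?(ltW mn) ?(ltW (m'0 n)).
rewrite [normc _]N.
have -> : m n / m' n * t ^+ n = m n * (t ^+ n / m' n) by ring.
move=> h; apply: ler_pM => //; first exact: ltW.
by rewrite divr_ge0 ?exprn_ge0// ltW.
Qed.

Theorem proposition2 (R : realType) (omega nu : R[i] -> R)
  (omega_doubling : doubling_weight omega) (nu_doubling : doubling_weight nu)
  (Bomega Bnu : disk R -> hol R)
  (Bomega_kernel : reproducing_kernel omega Bomega)
  (Bnu_kernel : reproducing_kernel nu Bnu) :
  exists! T : hol R -> hol R,
    [/\ linear T,
        continuous T,
        (forall (f : hol R) (r : R) (r01 : 0 < r < 1),
           dilate r01 (T f) = T (dilate r01 f)) &
        (forall z xi : disk R, T (Bomega z) xi = Bnu z xi)].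
Proof.
have [wo ro _ _ _] := omega_doubling; have [wn rn _ _ _] := nu_doubling.
have [m [m0 mE]] := kernel_coef wo ro Bomega_kernel.
have [m' [m'0 m'E]] := kernel_coef wn rn Bnu_kernel.
have mC n : (m n)%:C%C != 0 :> R[i].
  by have /andP[h _] := m0 n; rewrite -(rmorph0 (real_complex R)) (inj_eq (@complexI R)) gt_eqF.
have hg := @kernel_multiplier_disk_coefs R Bnu m m' m0 (fun n => proj1 (andP (m'0 n))) m'E.
exists (multiplier hg); split.
  split.
  - exact: multiplier_linear.
  - exact: multiplier_continuous.
  - by move=> f r r01; exact: multiplier_dilate.
  move=> z xi; suff -> : multiplier hg (Bomega z) = Bnu z by [].
  apply: coef_inj; rewrite coef_multiplier; apply/funext => n.
  rewrite mE m'E rmorphM/= fmorphV/= mulrC -mulrA; congr (_ * _).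
  by rewrite mulrA mulVf// mul1r.
move=> T [Tlin Tcont Tdil Tker].
have [gam gamE] := dilation_invariant_diagonal Tlin Tcont Tdil.
suff -> : T = multiplier hg by [].
apply/funext => f; apply: coef_inj; rewrite gamE coef_multiplier; apply/funext => n.
congr (_ * _).
(* Any nonzero z would do: all coefficients of [Bomega z] are then nonzero and can be cancelled. *)
have h1 : normc ((2^-1 : R)%:C%C : R[i]) < 1 by rewrite normc_real gtr0_norm; lra.
set z := to_disk h1.
have zn0 : (val z : R[i])^*%C ^+ n != 0.
  rewrite expf_eq0 negb_and conjc_eq0; apply/orP; right.
  by rewrite /= -(rmorph0 (real_complex R)) (inj_eq (@complexI R)) invr_eq0 pnatr_eq0.
have TB : T (Bomega z) = Bnu z by apply: hol_eq => xi; exact: Tker.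
have := congr1 (fun f => coef f n) TB; rewrite /= gamE mE m'E => E.
apply: (mulIf (_ : (val z : R[i])^*%C ^+ n / (m n)%:C%C != 0)).
  by rewrite mulf_neq0// invr_eq0.
rewrite E rmorphM/= fmorphV/=.
rewrite [RHS]mulrC -mulrA; congr (_ * _).
by rewrite mulrA mulVf// mul1r.
Qed.
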